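(* Let $d\ge1$, let $P\ge 2$ be an integer, and let $V:\mathbb{R}^d\to\mathbb{R}_{\ge 0}$ be smooth, $\mathbb{Z}^d$-periodic, and $P$-coercive, with bounded directional derivatives in every sequence of $P$ directions, i.e. there is an upper bound on $D^\alpha V(x)$, for $x\in\mathbb{R}^d$ and $\alpha\in\mathbb{N}^d$ with $\|\alpha\|_1\le P$, that is independent of $\alpha$ and $x$. Then for $\theta>0$ sufficiently small, $$\Big(1+O\big(\theta^{\frac{1}{2(P+1)}}\big)\Big)\,\mu(A_\theta)\;\ge\;\mu(B_\theta)-O\Big(\theta^{\,2-\frac{3P+1}{2P(P+1)}}\Big),$$ where the constants implicit in the $O(\cdot)$ notation do not depend on $\theta$ (they may depend on $V$, $d$, $P$).
   Context: For $\theta\in(0,1)$, the discrete Schrödinger operator $A_\theta:\ell_2(\theta\mathbb{Z}^d)\to\ell_2(\theta\mathbb{Z}^d)$ is $$A_\theta f(k\theta)=\Big(2d\,f(k\theta)-\sum_{j\sim k}f(j\theta)\Big)+V(k\theta)f(k\theta),\qquad k\in\mathbb{Z}^d,$$ where $j\sim k$ means that $j,k\in\mathbb{Z}^d$ are nearest neighbours, i.e. $j-k=\pm e_i$ for some coordinate vector $e_i$. The semiclassical Schrödinger operator $B_\theta:H^2(\mathbb{R}^d)\to L^2(\mathbb{R}^d)$ is $B_\theta g=-\theta^2\Delta g+Vg$. $\mu(A_\theta)$ and $\mu(B_\theta)$ denote the infima of the spectra of these self-adjoint operators (ground state energies); equivalently $$\mu(A_\theta)=\inf_{f\in\ell_2(\theta\mathbb{Z}^d),\,\|f\|=1}\Big(\sum_{\{j,k\}:\,j\sim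 k}(f(k\theta)-f(j\theta))^2+\sum_{k\in\mathbb{Z}^d}V(k\theta)f(k\theta)^2\Big),$$ $$\mu(B_\theta)=\inf_{g\in H^2(\mathbb{R}^d),\,\|g\|=1}\int_{\mathbb{R}^d}\theta^2\|\nabla g(x)\|^2+V(x)g(x)^2\,dx,$$ the first sum being over unordered pairs of neighbours. For a multi-index $\alpha\in\mathbb{N}^d$, $D^\alpha=(\partial/\partial x_1)^{\alpha_1}\cdots(\partial/\partial x_d)^{\alpha_d}$. Critical point: $m\in\mathbb{R}^d$ is a critical point of order $p$ of $V$ if $D^\alpha V(m)=0$ for all $\alpha$ with $\|\alpha\|_1\le p-1$ (including $\alpha=0$), and $D^\alpha V(m)\ne0$ for some $\alpha$ with $\|\alpha\|_1=p$. Coercivity: $V$ is $P$-coercive with parameters $(t_0,K,P)$, where $t_0>0$ and $K\ge1$, if for every $t\le t_0$ and $y\in\mathbb{R}^d$, $V(y)\le t+\inf V$ implies that there exists a critical point $m$ of some order $p$ with $2\le p\le P$ such that $\|y-m\|\le Kt^{1/p}$. $V$ is $P$-coercive if this holds for some $t_0,K$. *)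

(* Defs.v *)
From HB Require Import structures.
From mathcomp Require Import all_boot all_order all_algebra.
From mathcomp Require Import all_classical all_reals all_analysis.

Set Implicit Arguments.
Unset Strict Implicit.
Unset Printing Implicit Defensive.

Import Order.TTheory GRing.Theory Num.Theory.
Import numFieldNormedType.Exports.

Local Open Scope classical_set_scope.
Local Open Scope ring_scope.

(* R^d is 'rV[R]_d. Its sigma-algebra is generated by the coordinates, as for
   tuples in the library; it is the Borel sigma-algebra of R^d. *)
Definition rV_display : measure_display.
Proof. exact: default_measure_display. Qed.

Section measurable_rV.
Context {R : realType} (n : nat).

Definition rV_coord (i : 'I_n) (x : 'rV[R]_n) : measurableTypeR R := x ord0 i.

Let rV_set0 : g_sigma_preimage rV_coord set0.
Proof. exact: sigma_algebra0. Qed.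

Let rV_setC A : g_sigma_preimage rV_coord A -> g_sigma_preimage rV_coord (~` A).
Proof. exact: sigma_algebraC. Qed.

Let rV_bigcup (F : _^nat) : (forall i, g_sigma_preimage rV_coord (F i)) ->
  g_sigma_preimage rV_coord (\bigcup_i (F i)).
Proof. exact: sigma_algebra_bigcup. Qed.

HB.instance Definition _ := @isMeasurable.Build rV_display
  'rV[R]_n (g_sigma_preimage rV_coord) rV_set0 rV_setC rV_bigcup.

End measurable_rV.

Section lebesgue_rV.
Context {R : realType}.

Lemma measurable_rV_coord n (i : 'I_n) :
  measurable_fun [set: 'rV[R]_n] (rV_coord i).
Proof.
move=> _ Y mY; rewrite setTI; apply: sub_sigma_algebra => /=.
rewrite -bigcup_seq/=; exists i => /=; first by rewrite mem_index_enum.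
by exists Y => //; rewrite setTI.
Qed.

Lemma measurable_fun_rV d (T : measurableType d) n (f : T -> 'rV[R]_n) :
  (forall i, measurable_fun [set: T] (rV_coord i \o f)) ->
  measurable_fun [set: T] f.
Proof.
move=> mf _ A mA; rewrite setTI.
have : preimage_set_system setT f measurable (f @^-1` A).
  by exists A => //; rewrite setTI.
rewrite -[X in X _ -> _]/(preimage_set_system setT f (g_sigma_preimage (@rV_coord R n))).
rewrite -g_sigma_preimage_comp.
apply: smallest_sub; first exact: sigma_algebra_measurable.
move=> B; rewrite -bigcup_seq => -[i _ /= [C mC <-]]; exact: mf.
Qed.

Definition rV_cons n (vx : 'rV[R]_n * measurableTypeR R) : 'rV[R]_n.+1 :=
  row_mx (const_mx vx.2 : 'rV[R]_1) vx.1.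

Lemma rV_cons0 n v x : @rV_cons n (v, x) ord0 ord0 = x.
Proof.
have -> : ord0 = lshift n ord0 :> 'I_(1 + n) by exact: val_inj.
exact: (etrans (row_mxEl _ _ _ _) (mxE _ _ _ _)).
Qed.

Lemma rV_consS n v x j : @rV_cons n (v, x) ord0 (lift ord0 j) = v ord0 j.
Proof.
have -> : lift ord0 j = rshift 1 j :> 'I_(1 + n) by exact: val_inj.
exact: row_mxEr.
Qed.

Lemma measurable_rV_cons n : measurable_fun setT (@rV_cons n).
Proof.
apply: measurable_fun_rV => i; case: (unliftP ord0 i) => [j ->|->].
  rewrite (_ : _ \o _ = rV_coord j \o fst).
    by apply: measurableT_comp => //; exact: measurable_rV_coord.
  by apply/funext => -[v x]; exact: rV_consS.
by rewrite (_ : _ \o _ = snd)//; apply/funext => -[v x]; exact: rV_cons0.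
Qed.

(* d-dimensional Lebesgue measure, as the d-fold product of the Lebesgue
   measure on R (the value on boxes is computed in lebesgue_rV_box). *)
Fixpoint lebesgue_rV n : set 'rV[R]_n -> \bar R :=
  match n with
  | 0 => \d_(0 : 'rV[R]_0)
  | k.+1 => pushforward (@lebesgue_rV k \x @lebesgue_measure R)%E (@rV_cons k)
  end.

Fact lebesgue_rV_measure n :
  [/\ lebesgue_rV (set0 : set 'rV[R]_n) = 0%E, (forall A : set 'rV[R]_n, 0 <= lebesgue_rV A)%E
    & semi_sigma_additive (@lebesgue_rV n)].
Proof.
elim: n => [|n [m0 m_ge0 m_add]].
  split; [exact: measure0|by move=> A; exact: measure_ge0|].
  exact: measure_semi_sigma_additive.
pose m := isMeasure.Build _ _ _ (@lebesgue_rV n) m0 m_ge0 m_add.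
pose mu : {measure set 'rV[R]_n -> \bar R} := HB.pack (@lebesgue_rV n) m.
have mc := @measurable_rV_cons n.
have mP B : measurable B -> measurable (@rV_cons n @^-1` B).
  by move=> mB; rewrite -[X in measurable X]setTI; exact: mc.
split => [|A|F mF tF mUF].
- by rewrite /= /pushforward preimage_set0 (measure0 (mu \x lebesgue_measure)%E).
- exact: (@measure_ge0 _ _ _ (mu \x lebesgue_measure)%E).
- rewrite /= /pushforward preimage_bigcup.
  apply: (@measure_semi_sigma_additive _ _ _ (mu \x lebesgue_measure)%E).
  + by move=> k; exact: mP.
  + apply/trivIsetP => i j _ _ ij; rewrite -preimage_setI.
    by move/trivIsetP : tF => /(_ _ _ _ _ ij) ->//; rewrite preimage_set0.
  + by rewrite -preimage_bigcup; exact: mP.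
Qed.

HB.instance Definition _ n := isMeasure.Build _ _ _ (@lebesgue_rV n)
  (let: And3 h _ _ := lebesgue_rV_measure n in h)
  (let: And3 _ h _ := lebesgue_rV_measure n in h)
  (let: And3 _ _ h := lebesgue_rV_measure n in h).

Lemma lebesgue_rV_box n (A : 'I_n -> set (measurableTypeR R)) :
  (forall i, measurable (A i)) ->
  lebesgue_rV [set x : 'rV[R]_n | forall i, A i (x ord0 i)] =
  (\prod_(i < n) lebesgue_measure (A i))%E.
Proof.
elim: n A => [|n IH] A mA.
  rewrite big_ord0 /= (_ : [set _ | _] = setT) ?diracT//.
  by apply/seteqP; split=> // x _ [].
rewrite big_ord_recl /= /pushforward.
rewrite (_ : _ @^-1` _ =
  [set v : 'rV[R]_n | forall i, A (lift ord0 i) (v ord0 i)] `*` A ord0).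
  rewrite product_measure1E//; first by rewrite muleC; congr (_ * _)%E; exact: IH.
  rewrite (_ : [set _ | _] = \bigcap_(i in [set: 'I_n])
    (@rV_coord R n i @^-1` A (lift ord0 i))); last first.
    by apply/seteqP; split=> [v h i _|v h i]; [exact: h|exact: (h i I)].
  apply: fin_bigcap_measurable => [|i _]; first exact: finite_finset.
  by rewrite -[X in measurable X]setTI; exact: measurable_rV_coord.
apply/seteqP; split=> -[v x] /= h.
  split=> [i|]; first by have := h (lift ord0 i); rewrite rV_consS.
  by have := h ord0; rewrite rV_cons0.
move=> i; case: (unliftP ord0 i) => [j ->|->]; last by rewrite rV_cons0; case: h.
by rewrite rV_consS; case: h => + _; exact.
Qed.

End lebesgue_rV.

Section smooth_functions.
Context {R : realType} {d : nat}.
Implicit Types (V g h : 'rV[R]_d -> R) (alpha : 'I_d -> nat) (x m : 'rV[R]_d).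

(* The library norm on 'rV[R]_d is the sup norm. *)
Definition euclidean_norm x : R := Num.sqrt (\sum_(i < d) x ord0 i ^+ 2).

Definition partial (i : 'I_d) V : 'rV[R]_d -> R :=
  fun x => 'D_(delta_mx ord0 i) V x.

Definition iter_partial (s : seq 'I_d) V : 'rV[R]_d -> R := foldr partial V s.

(* 'D_v is total: it takes a default value where the derivative does not
   exist, hence the derivability clause. *)
Definition smooth V : Prop := forall s : seq 'I_d,
  continuous (iter_partial s V) /\
  forall (i : 'I_d) x, derivable (iter_partial s V) x (delta_mx ord0 i).

Definition order_of alpha : nat := \sum_(i < d) alpha i.

Definition Dpartial alpha V : 'rV[R]_d -> R :=
  iter_partial (flatten [seq nseq (alpha i) i | i <- enum 'I_d]) V.

Definition Zd_periodic V : Prop :=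
  forall x (k : 'rV[int]_d), V (x + map_mx intr k) = V x.

Definition critical_point V (p : nat) m : Prop :=
  (forall alpha, (order_of alpha < p)%N -> Dpartial alpha V m = 0) /\
  (exists2 alpha, order_of alpha = p & Dpartial alpha V m != 0).

Definition coercive_with V (t0 K : R) (P : nat) : Prop :=
  forall t y, t <= t0 -> V y <= t + inf (range V) ->
    exists (p : nat) m, [/\ (2 <= p <= P)%N, critical_point V p m
      & euclidean_norm (y - m) <= K * t `^ (p%:R^-1)].

Definition coercive V (P : nat) : Prop :=
  exists t0 K : R, [/\ 0 < t0, 1 <= K & coercive_with V t0 K P].

Definition bounded_derivatives V (P : nat) : Prop :=
  exists M : R, forall alpha x, (order_of alpha <= P)%N ->
    `|Dpartial alpha V x| <= M.

End smooth_functions.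

Section ground_state_energies.
Context {R : realType} {d : nat}.
Implicit Types (V : 'rV[R]_d -> R) (theta : R).

(* A function f on the lattice theta Z^d is encoded by k |-> f (k theta) on
   Z^d. *)
Definition lattice_point theta (k : 'rV[int]_d) : 'rV[R]_d :=
  theta *: map_mx intr k.

Definition l2_norm_sqr (f : 'rV[int]_d -> R) : \bar R :=
  \esum_(k in [set: 'rV[int]_d]) (f k ^+ 2)%:E.

(* Every unordered pair of neighbours is {k, k + e_i} for exactly one (k, i). *)
Definition discrete_energy V theta (f : 'rV[int]_d -> R) : \bar R :=
  (\esum_(e in [set: 'rV[int]_d * 'I_d])
     ((f (e.1 + delta_mx ord0 e.2)%R - f e.1) ^+ 2)%:E
   + \esum_(k in [set: 'rV[int]_d]) (V (lattice_point theta k) * f k ^+ 2)%:E)%E.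

Definition mu_A V theta : \bar R :=
  ereal_inf [set discrete_energy V theta f | f in [set f | l2_norm_sqr f = 1%E]].

Definition test_function (phi : 'rV[R]_d -> R) : Prop :=
  smooth phi /\ compact (closure [set x | phi x != 0]).

Definition L2 : set ('rV[R]_d -> R) :=
  [set g | g \in Lfun (@lebesgue_rV R d) 2%:E].

Definition weak_derivative (alpha : 'I_d -> nat) (g h : 'rV[R]_d -> R) : Prop :=
  forall phi, test_function phi ->
    \int[@lebesgue_rV R d]_x (g x * Dpartial alpha phi x) =
    (-1) ^+ order_of alpha * \int[@lebesgue_rV R d]_x (h x * phi x).

Definition H2 : set ('rV[R]_d -> R) :=
  [set g | L2 g /\ forall alpha : 'I_d -> nat, (order_of alpha <= 2)%N ->
    exists2 h, L2 h & weak_derivative alpha g h].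

(* Weak derivatives are unique up to a null set, so that the energy below does
   not depend on the choice of the gradient. *)
Definition weak_gradient (g : 'rV[R]_d -> R) (G : 'I_d -> 'rV[R]_d -> R) :=
  forall i, L2 (G i) /\ weak_derivative (fun j => (j == i)%N) g (G i).

Definition continuous_energy V theta (g : 'rV[R]_d -> R)
    (G : 'I_d -> 'rV[R]_d -> R) : \bar R :=
  (\int[@lebesgue_rV R d]_x
     (theta ^+ 2 * (\sum_(i < d) G i x ^+ 2) + V x * g x ^+ 2)%:E)%E.

Definition mu_B V theta : \bar R :=
  ereal_inf [set E | exists g G, [/\ H2 g,
    ('N[@lebesgue_rV R d]_(2%:E)[EFin \o g] = 1)%E, weak_gradient g G
    & E = continuous_energy V theta g G]].

End ground_state_energies.

(* Main.v *)
From HB Require Import structures.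
Require Import Defs.
From mathcomp Require Import all_boot all_order all_algebra.
From mathcomp Require Import all_classical all_reals all_analysis.
From mathcomp Require Import measurable_realfun ring lra zify.
Import Order.TTheory GRing.Theory Num.Theory.
Import numFieldNormedType.Exports.
Local Open Scope classical_set_scope.
Local Open Scope ring_scope.
Set Implicit Arguments.
Unset Strict Implicit.
Unset Printing Implicit Defensive.

(* A finitely supported lattice function c is turned into the C^2 function
   g x = \sum_k c k * \prod_i beta (x_i / theta - k_i), with beta the cubic
   B-spline. Its weights form a partition of unity and beta' is a difference of
   two translates of the quadratic B-spline, so theta * d_i g is a weighted
   average of the differences c k - c (k - e_i); by Jensen's inequality and
   Tonelli the kinetic energy of g is at most theta ^ d times that of c, without
   any loss. Since V >= 0 has bounded second derivatives, it satisfies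
   V y <= (1 + O(delta)) V x + O(theta ^ 2 / delta) as soon as
   |x - y| = O(theta), which compares the potential energies. Finally
   theta ^ d |c|^2 - |g|^2 is bounded by theta ^ d times a multiple of the
   kinetic energy of c. With delta = theta ^ (1 / (2 (P + 1))) the additive error
   is O(theta ^ (2 - 1 / (2 (P + 1)))), which is even smaller than required. The
   loss in the norm is harmless because mu_A = O(delta), as the indicator of a
   box around a zero of V shows; coercivity only provides that zero. *)

(** * B-splines *)

(** Degree 3 is dictated by the domain of [mu_B]: membership in H^2 asks for two derivatives, which
    excludes multilinear interpolation although its gradient also averages differences. Two
    estimates are delicate. Comparing V at points at distance O(theta) naively costs O(theta), far
    more than the allowed additive error; but a nonnegative function with bounded second derivatives
    has gradient O(sqrt V), so the first-order term splits into delta * V and theta ^ 2 / delta.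
    Moreover, Jensen bounds the norm of g from above, whereas a Rayleigh quotient needs it from
    below: the deficit is a local variance of c, bounded by squared differences along finitely many
    fixed shifts. This bound carries no small factor, so it is a relative O(delta) only for
    near-minimisers, once [mu_A] is known to be O(delta). Finite support, reached by cutting off a
    near-minimiser, turns averages into finite sums and gives g the bounded support needed to
    integrate by parts. *)

Section bspline.
Context {R : realType}.
Implicit Types (t s : R) (u v : R -> R) (n j : nat).

(** The truncated power t_+^n / n!, normalised so that a derivative lowers n by one. At n = 0 it is
    the constant 1 and not the Heaviside function, hence [n.+1] in [tpow_le0]; differentiability at
    0 starts at degree 2. *)
Definition tpow n t : R := Num.max t 0 ^+ n / n`!%:R.

Definition bdiff u : R -> R := fun t => u t - u (t - 1).

Lemma tpow_le0 n t : t <= 0 -> tpow n.+1 t = 0.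
Proof. by move=> t0; rewrite /tpow max_r// expr0n mul0r. Qed.

Lemma tpow_ge0 n t : 0 <= t -> tpow n t = t ^+ n / n`!%:R.
Proof. by move=> t0; rewrite /tpow max_l. Qed.

Lemma continuous_tpow n : continuous (tpow n).
Proof.
move=> t; rewrite /tpow; apply: cvgMl.
have c : {for t, continuous (fun x : R => Num.max x 0)}.
  by apply: continuous_max; [exact: cvg_id|exact: cvg_cst].
exact: (continuous_comp c (@exprn_continuous R n _)).
Qed.

Lemma is_derive_tpow n t : is_derive t 1 (tpow n.+2) (tpow n.+1 t).
Proof.
have f0 k : k`!%:R != 0 :> R by rewrite pnatr_eq0 -lt0n fact_gt0.
have n20 k : k.+2%:R != 0 :> R by rewrite pnatr_eq0.
have [t0|t0|->] := ltgtP t 0.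
- rewrite tpow_le0 ?ltW//.
  apply: (@near_eq_is_derive _ _ _ (cst 0)).
  by near=> x; rewrite tpow_le0// ltW//; near: x; exact: lt_nbhsl.
- rewrite tpow_ge0 ?ltW//.
  have dX : is_derive t 1 ((n.+2`!%:R)^-1 \*: (fun x : R => x) ^+ n.+2)
      (t ^+ n.+1 / n.+1`!%:R).
    apply: is_derive_eq; rewrite -[LHS]/(_ * (_ * _)) /= factS natrM mulr1.
    by move: (n.+2%:R : R) (n20 n) (f0 n.+1) => N N0 F0; field; rewrite F0 N0.
  apply: near_eq_is_derive dX.
  near=> x; rewrite tpow_ge0 ?ltW//; last by near: x; exact: lt_nbhsr.
  by rewrite /= exprfctE mulrC.
- rewrite tpow_le0//; apply/is_derive1_caratheodory.
  (* The slope of [tpow n.+2] seen from the origin; it is continuous and vanishes at 0. *)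
  exists (fun z => tpow n.+1 z / n.+2%:R); split.
  + move=> z; rewrite (tpow_le0 _ (lexx 0)) !subr0 /tpow factS natrM.
    have [z0|z0] := leP z 0; first by rewrite !expr0n !mul0r.
    rewrite [in LHS]exprS.
    by move: (n.+2%:R : R) (n20 n) (f0 n.+1) => N N0 F0; field; rewrite F0 N0.
  + by apply: cvgMl; exact: continuous_tpow.
  + by rewrite tpow_le0// mul0r.
Unshelve. all: by end_near. Qed.

Lemma is_derive_shiftB u (a t : R) du : is_derive (t - a) 1 u du ->
  is_derive t 1 (fun x => u (x - a)) du.
Proof.
move=> h; rewrite -[du]mulr1.
by apply: (@is_derive1_comp _ u (fun x => x - a)); apply: is_derive_shift.
Qed.

Lemma is_derive_bdiff u v t : (forall t, is_derive t 1 u (v t)) ->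
  is_derive t 1 (bdiff u) (bdiff v t).
Proof.
move=> uv; have d1 := uv t; have d2 := is_derive_shiftB (uv (t - 1)).
exact: (is_deriveB d1 d2).
Qed.

Lemma continuous_bdiff u : continuous u -> continuous (bdiff u).
Proof.
move=> cu t; apply: cvgB; first exact: cu.
have c : {for t, continuous (fun x : R => x - 1)}.
  by apply: cvgB; [exact: cvg_id|exact: cvg_cst].
exact: (continuous_comp c (cu _)).
Qed.

(* bpow n.+1 n is the B-spline of degree n, supported in [0, n + 1]. *)
Definition bpow j n : R -> R := iter j bdiff (tpow n).

Lemma continuous_bpow j n : continuous (bpow j n).
Proof.
by elim: j => [|j IH]; [exact: continuous_tpow|exact: continuous_bdiff].
Qed.

Lemma is_derive_bpow j n t : is_derive t 1 (bpow j n.+2) (bpow j n.+1 t).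
Proof.
elim: j t => [|j IH] t; first exact: is_derive_tpow.
exact: is_derive_bdiff.
Qed.

Lemma bpow_le0 j n t : t <= 0 -> bpow j n.+1 t = 0.
Proof.
elim: j t => [|j IH] t t0 /=; first exact: tpow_le0.
by rewrite /bdiff !IH ?subr0//; lra.
Qed.

(** The j-th backward difference of t^j / j! is 1, and from t = j on none of the powers involved is
    truncated. *)
Lemma bpow2 t : 2 <= t -> bpow 2 2 t = 1.
Proof.
by move=> t2; rewrite /bpow /= /bdiff !tpow_ge0 ?factS ?fact0; [field|lra..].
Qed.

Lemma bpow3 t : 3 <= t -> bpow 3 3 t = 1.
Proof.
by move=> t2; rewrite /bpow /= /bdiff !tpow_ge0 ?factS ?fact0; [field|lra..].
Qed.

Lemma bpow4 t : 4 <= t -> bpow 4 4 t = 1.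
Proof.
by move=> t2; rewrite /bpow /= /bdiff !tpow_ge0 ?factS ?fact0; [field|lra..].
Qed.

(** Mean value theorem on [t - 1, t]. It carries nonnegativity from the hat function [bpow 2 1] to
    the quadratic and then to the cubic B-spline. *)
Lemma bdiff_ge0 u v : (forall t, is_derive t 1 u (v t)) ->
  (forall t, 0 <= v t) -> forall t, 0 <= bdiff u t.
Proof.
move=> uv v0 t; have [||c _] := @MVT_segment _ u v (t - 1) t; first lra.
- have cu : continuous u.
    move=> y; apply: differentiable_continuous; apply/derivable1_diffP.
    by case: (uv y).
  exact: continuous_subspaceT.
- by rewrite /bdiff => ->; rewrite mulr_ge0//; lra.
Qed.

Lemma bpow21_ge0 t : 0 <= bpow 2 1 t.
Proof.
rewrite /bpow /= /bdiff /tpow /= !expr1 factS fact0 divr1.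
have [] := leP t 0; have [] := leP (t - 1) 0; have [] := leP (t - 1 - 1) 0; lra.
Qed.

Lemma bpow32_ge0 t : 0 <= bpow 3 2 t.
Proof.
exact: (@bdiff_ge0 (bpow 2 2) _ (fun s => is_derive_bpow 2 0 s) bpow21_ge0).
Qed.

Lemma bpow43_ge0 t : 0 <= bpow 4 3 t.
Proof.
exact: (@bdiff_ge0 (bpow 3 3) _ (fun s => is_derive_bpow 3 1 s) bpow32_ge0).
Qed.

(** What a one-variable factor of a weight must satisfy. The quadratic spline lives on (0, 3) but is
    given the interval (0, 4) of the cubic one, so that weights mixing the two share one window of
    four lattice points per coordinate. *)
Record profile (h : R -> R) := Profile {
  profile_cont : continuous h ;
  profile_ge0 : forall t, 0 <= h t ;
  profile_supp : forall t, h t != 0 -> 0 < t < 4 ;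
  profile_unit : forall t, 0 <= t < 1 -> \sum_(j < 4) h (t + j%:R) = 1 ;
  profile_prim : exists H, [/\ forall t, is_derive t 1 H (h t), H 0 = 0 & H 4 = 1]
}.

Lemma bdiff_profile u h H : bdiff u = h -> continuous h -> (forall t, 0 <= h t) ->
  (forall t, t <= 0 -> u t = 0) -> (forall t, 3 <= t -> u t = 1) ->
  (forall t, is_derive t 1 H (h t)) -> H 0 = 0 -> H 4 = 1 -> profile h.
Proof.
move=> uh ch h0 u0 u1 Hh H0 H1; split => //.
- move=> t; apply: contraR; rewrite -uh /bdiff.
  have [t0 _|t0] := leP t 0; first by rewrite !u0 ?subrr//; lra.
  by rewrite -leNgt => t4; rewrite !u1 ?subrr//; lra.
(* The four differences telescope to u (t + 3) - u (t - 1) = 1 - 0. *)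
- move=> t t01; rewrite !big_ord_recl big_ord0 /= -uh /bdiff /bump /=.
  rewrite (u0 (t + 0%:R - 1)); last by lra.
  rewrite (u1 (t + (1 + (1 + 1))%:R)); last by lra.
  rewrite (_ : t + 1%:R - 1 = t + 0%:R); last by ring.
  rewrite (_ : t + (1 + 1)%:R - 1 = t + 1%:R); last by ring.
  by rewrite (_ : t + (1 + (1 + 1))%:R - 1 = t + (1 + 1)%:R); ring.
- by exists H.
Qed.

Definition quadratic_bspline := bpow 3 2.
Definition cubic_bspline := bpow 4 3.

Lemma quadratic_profile : profile quadratic_bspline.
Proof.
apply: (@bdiff_profile (bpow 2 2) _ (bpow 3 3)) => //.
- exact: continuous_bpow.
- exact: bpow32_ge0.
- by move=> t; exact: bpow_le0.
- by move=> t t3; apply: bpow2; lra.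
- by move=> t; exact: is_derive_bpow.
- exact: bpow_le0.
- by apply: bpow3; lra.
Qed.

Lemma cubic_profile : profile cubic_bspline.
Proof.
apply: (@bdiff_profile (bpow 3 3) _ (bpow 4 4)) => //.
- exact: continuous_bpow.
- exact: bpow43_ge0.
- by move=> t; exact: bpow_le0.
- by move=> t t3; apply: bpow3.
- by move=> t; exact: is_derive_bpow.
- exact: bpow_le0.
- by apply: bpow4; lra.
Qed.

End bspline.

(** * Lebesgue measure on row vectors *)

Section lebesgue_rV_theory.
Context {R : realType}.

Definition rbox n (B : R) : set 'rV[R]_n :=
  [set x | forall i, `[- B, B]%classic (x ord0 i)].

Lemma measurable_rbox n B : measurable (@rbox n B).
Proof.
rewrite (_ : @rbox n B = \bigcap_(i in [set: 'I_n])
    (@rV_coord R n i @^-1` `[- B, B])); last first.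
  by apply/seteqP; split=> [v h i _|v h i]; [exact: h|exact: (h i I)].
apply: fin_bigcap_measurable => [|i _]; first exact: finite_finset.
by rewrite -[X in measurable X]setTI; exact: measurable_rV_coord.
Qed.

Lemma lebesgue_rV_rbox_lty n B : (@lebesgue_rV R n (@rbox n B) < +oo)%E.
Proof.
rewrite (@lebesgue_rV_box R n (fun=> `[- B, B]%classic))//.
rewrite -ge0_fin_numE; last exact: prode_ge0.
elim/big_ind : _ => // [x y xf yf|i _]; first exact: fin_numM.
by rewrite ge0_fin_numE//; apply: compact_finite_measure; exact: segment_compact.
Qed.

Lemma lebesgue_rV_sigma_finite n : sigma_finite [set: 'rV[R]_n] (@lebesgue_rV R n).
Proof.
exists (fun k => @rbox n k%:R) => [|k]; last first.
  by split; [exact: measurable_rbox|exact: lebesgue_rV_rbox_lty].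
apply/seteqP; split => // x _.
exists (\max_(i < n) Num.truncn `|x ord0 i|).+1 => //= i.
rewrite /= in_itv /= -ler_norml; apply: (le_trans (ltW (truncnS_gt _))).
by rewrite ler_nat ltnS; exact: leq_bigmax.
Qed.

HB.instance Definition _ n := @Measure_isSigmaFinite.Build _ _ _
  (@lebesgue_rV R n) (@lebesgue_rV_sigma_finite n).

(** The sigma-algebra is generated by the coordinates, so preimages of open sets are not measurable
    by definition. Here u is the pointwise limit of x |-> u (q m (fl m x)), where x is rounded down
    to the grid of mesh 1 / (m + 1); each of these functions is constant on countably many boxes. *)
Lemma continuous_measurable_rV n (u : 'rV[R]_n -> R) :
  continuous u -> measurable_fun setT u.
Proof.
move=> cu.
pose q (m : nat) (k : 'rV[int]_n) : 'rV[R]_n :=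
  \row_i ((k ord0 i)%:~R / m.+1%:R).
pose fl (m : nat) (x : 'rV[R]_n) : 'rV[int]_n :=
  \row_i Num.floor (m.+1%:R * x ord0 i).
have m0 (m : nat) : 0 < m.+1%:R :> R by rewrite ltr0n.
apply: (@measurable_fun_cvg _ _ _ setT (fun m x => u (q m (fl m x)))).
- move=> m _ Y mY; rewrite setTI.
  rewrite (_ : _ @^-1` _ = \bigcup_k
      ([set x | fl m x = k] `&` [set x | Y (u (q m k))])); last first.
    apply/seteqP; split => [x /= Yx|x [k _] /= [<-]//].
    by exists (fl m x).
  apply: countable_bigcupT_measurable; first exact: (@countableP _ [set: _]).
  move=> k; apply: measurableI; last first.
    have [h|h] := pselect (Y (u (q m k))).
      by rewrite (_ : [set _ | _] = setT)//; apply/seteqP; split.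
    by rewrite (_ : [set _ | _] = set0)//; apply/seteqP; split.
  rewrite (_ : [set _ | _] = \bigcap_(i in [set: 'I_n])
    (@rV_coord R n i @^-1`
      `[(k ord0 i)%:~R / m.+1%:R, (k ord0 i + 1)%:~R / m.+1%:R[)).
    apply: fin_bigcap_measurable => [|i _]; first exact: finite_finset.
    by rewrite -[X in measurable X]setTI; exact: measurable_rV_coord.
  have E (x : 'rV[R]_n) i : (Num.floor (m.+1%:R * x ord0 i) == k ord0 i) =
      (rV_coord i x \in `[(k ord0 i)%:~R / m.+1%:R, (k ord0 i + 1)%:~R / m.+1%:R[).
    by rewrite floor_eq in_itv /= ler_pdivrMr// ltr_pdivlMr// [_ * m.+1%:R]mulrC.
  apply/seteqP; split => [x /= h i _|x h].
    by rewrite /preimage /= -E -h mxE.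
  by apply/rowP => i; rewrite mxE; apply/eqP; rewrite E; exact: (h i I).
- move=> x _; suff qx : q m (fl m x) @[m --> \oo] --> x.
    exact: (cvg_comp _ _ qx (cu x)).
  apply/cvg_ballP => e e0.
  near=> m; split => // i j; rewrite !mxE ord1 /ball /=.
  have /andP[h1 h2] := floor_itv (m.+1%:R * x ord0 j).
  have lt1 : m.+1%:R^-1 < e by near: m; exact: near_infty_natSinv_lt (PosNum e0).
  rewrite ger0_norm; last by rewrite subr_ge0 ler_pdivrMr// [X in _ <= X]mulrC.
  apply: lt_trans lt1; rewrite ltrBlDr -[X in X + _]mul1r -mulrDl ltr_pdivlMr//.
  by rewrite [X in X < _]mulrC addrC; rewrite intrD in h2.
Unshelve. all: by end_near. Qed.

End lebesgue_rV_theory.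

(** * Fubini, integrals of tensor products, continuous functions of bounded support *)

Section integration.
Context {R : realType}.
Implicit Types n : nat.

Notation mu n := (@lebesgue_rV R n).

Lemma ge0_integral_rV_cons n (f : 'rV[R]_n.+1 -> \bar R) :
  measurable_fun setT f -> (forall x, 0 <= f x)%E ->
  (\int[mu n.+1]_x f x =
   \int[mu n]_v \int[lebesgue_measure]_t f (rV_cons (v, t)))%E.
Proof.
move=> mf f0.
rewrite (ge0_integral_pushforward (@measurable_rV_cons R n)
  (mu n \x lebesgue_measure)%E)//.
rewrite preimage_setT (fubini_tonelli1 (f \o @rV_cons R n))//.
  exact: measurableT_comp (@measurable_rV_cons R n).
by move=> x; exact: f0.
Qed.

Lemma integrable_rV_cons n (f : 'rV[R]_n.+1 -> \bar R) :
  measurable_fun setT f -> (mu n.+1).-integrable setT f ->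
  (mu n \x lebesgue_measure)%E.-integrable setT (f \o @rV_cons R n).
Proof.
move=> mf /integrableP[_]; rewrite ge0_integral_rV_cons//; last first.
  exact: measurableT_comp.
move=> fi; apply/integrable12ltyP => //.
exact: measurableT_comp (@measurable_rV_cons R n).
Qed.

Lemma integral_rV_cons n (f : 'rV[R]_n.+1 -> \bar R) :
  measurable_fun setT f -> (mu n.+1).-integrable setT f ->
  (\int[mu n.+1]_x f x =
   \int[mu n]_v \int[lebesgue_measure]_t f (rV_cons (v, t)))%E.
Proof.
move=> mf fi; have fi' := integrable_rV_cons mf fi.
rewrite (integral_pushforward (@measurable_rV_cons R n)
  (mu := (mu n \x lebesgue_measure)%E))// preimage_setT.
by rewrite -integral12_prod_meas1.
Qed.

Lemma integral_rV_consC n (f : 'rV[R]_n.+1 -> \bar R) :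
  measurable_fun setT f -> (mu n.+1).-integrable setT f ->
  (\int[mu n.+1]_x f x =
   \int[lebesgue_measure]_t \int[mu n]_v f (rV_cons (v, t)))%E.
Proof.
move=> mf fi; have fi' := integrable_rV_cons mf fi.
rewrite (integral_pushforward (@measurable_rV_cons R n)
  (mu := (mu n \x lebesgue_measure)%E))// preimage_setT.
by rewrite -integral21_prod_meas1.
Qed.

Definition tensor n (h : 'I_n -> R -> R) (x : 'rV[R]_n) : R :=
  \prod_(i < n) h i (x ord0 i).

Lemma continuous_tensor n (h : 'I_n -> R -> R) :
  (forall i, continuous (h i)) -> continuous (tensor h).
Proof.
move=> ch x; rewrite /tensor.
elim: (index_enum _) => [|i s IH].
  rewrite (_ : (fun _ => _) = cst 1); last by apply/funext => y; rewrite big_nil.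
  exact: cst_continuous.
rewrite (_ : (fun _ => _) = (fun y : 'rV[R]_n => h i (y ord0 i)) \*
    (fun y : 'rV[R]_n => \prod_(j <- s) h j (y ord0 j))); last first.
  by apply/funext => y; rewrite big_cons.
apply: continuousM => //.
have c : {for x, continuous (fun y : 'rV[R]_n => y ord0 i)} by exact: coord_continuous.
exact: (continuous_comp c (ch i _)).
Qed.

Lemma tensor_cons n (h : 'I_n.+1 -> R -> R) v t :
  tensor h (rV_cons (v, t)) = h ord0 t * tensor (fun i => h (lift ord0 i)) v.
Proof.
rewrite /tensor big_ord_recl rV_cons0; congr (_ * _).
by apply: eq_bigr => i _; rewrite rV_consS.
Qed.

Lemma tensor_ge0 n (h : 'I_n -> R -> R) : (forall i t, 0 <= h i t) ->
  forall x, 0 <= tensor h x.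
Proof. by move=> h0 x; apply: prodr_ge0. Qed.

Lemma integral_tensor n (h : 'I_n -> R -> R) (c : 'I_n -> R) :
  (forall i, continuous (h i)) -> (forall i t, 0 <= h i t) ->
  (forall i, \int[lebesgue_measure]_t (h i t)%:E = (c i)%:E)%E ->
  (\int[mu n]_x (tensor h x)%:E = (\prod_(i < n) c i)%:E)%E.
Proof.
elim: n h c => [|n IH] h c ch h0 hc.
  rewrite big_ord0 (_ : (fun _ => _) = cst 1%E).
    by rewrite integral_cst// mul1e; exact: diracT.
  by apply/funext => x; rewrite /tensor big_ord0.
rewrite ge0_integral_rV_cons; last 2 first.
- apply/measurable_EFinP; apply: continuous_measurable_rV.
  by apply: continuous_tensor => i; exact: ch.
- by move=> x; rewrite lee_fin tensor_ge0.
have mh i : measurable_fun setT (fun t => (h i t)%:E).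
  by apply/measurable_EFinP; apply: continuous_measurable_fun; exact: ch.
transitivity (\int[mu n]_v
    ((c ord0)%:E * (tensor (fun i => h (lift ord0 i)) v)%:E))%E.
  apply: eq_integral => v _.
  rewrite -hc -ge0_integralZr//.
  + by apply: eq_integral => t _; rewrite tensor_cons EFinM.
  + exact: mh.
  + by move=> t _; rewrite lee_fin.
  + by rewrite lee_fin tensor_ge0.
have c0 : (0 <= (c ord0)%:E)%E.
  by rewrite -hc; apply: integral_ge0 => t _; rewrite lee_fin.
rewrite ge0_integralZl//.
- by rewrite (IH _ (fun i => c (lift ord0 i)))// -EFinM big_ord_recl.
- apply/measurable_EFinP; apply: continuous_measurable_rV.
  by apply: continuous_tensor => i; exact: ch.
- by move=> x _; rewrite lee_fin tensor_ge0.
Qed.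

Definition Cc n (u : 'rV[R]_n -> R) : Prop :=
  continuous u /\ exists B, forall x, u x != 0 -> rbox B x.

Lemma Cc_bounded n (u : 'rV[R]_n -> R) : Cc u -> exists M : R, forall x, `|u x| <= M.
Proof.
move=> [cu [B uB]].
have : compact (u @` @rbox R n B).
  apply: continuous_compact; first exact: continuous_subspaceT.
  apply: (@rV_compact R n (fun=> `[- B, B]%classic)) => i.
  exact: segment_compact.
move/compact_bounded => [M [_ hM]]; exists (`|M| + 1) => x.
have [->|/uB xB] := eqVneq (u x) 0; first by rewrite normr0.
by apply: (hM (`|M| + 1)); [rewrite (le_lt_trans (ler_norm _))// ltrDl|exists x].
Qed.

Lemma Cc_integrable n (u : 'rV[R]_n -> R) : Cc u ->
  (mu n).-integrable setT (EFin \o u).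
Proof.
move=> Cu; have [M uM] := Cc_bounded Cu; have [cu [B uB]] := Cu.
rewrite (_ : EFin \o u = (EFin \o u) \_ (@rbox R n B)); last first.
  apply/funext => x; rewrite patchE; case: ifPn => // /negP xB /=.
  by have [->//|/uB h] := eqVneq (u x) 0; case: xB; rewrite inE.
apply/(integrable_mkcond (EFin \o u) (@measurable_rbox R n B)).
apply: measurable_bounded_integrable.
- exact: measurable_rbox.
- exact: lebesgue_rV_rbox_lty.
- by apply: measurable_funTS; exact: continuous_measurable_rV.
- by exists M; split; [exact: num_real|move=> y My x _; exact: (le_trans (uM x) (ltW My))].
Qed.

Lemma CcM n (u v : 'rV[R]_n -> R) : Cc u -> continuous v -> Cc (fun x => u x * v x).
Proof.
move=> [cu [B uB]] cv; split; first by move=> x; exact: (continuousM (cu x) (cv x)).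
by exists B => x; rewrite mulf_eq0 negb_or => /andP[/uB].
Qed.

Lemma Cc_sum n (I : Type) (s : seq I) (u : I -> 'rV[R]_n -> R) :
  (forall i, Cc (u i)) -> Cc (fun x => \sum_(i <- s) u i x).
Proof.
move=> Cu; elim: s => [|i s [ch [B hB]]].
  split; last by exists 0 => x; rewrite big_nil eqxx.
  rewrite (_ : (fun _ => _) = cst 0); last by apply/funext => y; rewrite big_nil.
  exact: cst_continuous.
have [ci [B' hB']] := Cu i.
split.
  rewrite (_ : (fun _ => _) = u i \+ (fun x => \sum_(i <- s) u i x)).
    by move=> x; exact: (continuousD (ci x) (ch x)).
  by apply/funext => x; rewrite big_cons.
exists (Num.max B B') => x; rewrite big_cons => h j /=.
suff [] : `|x ord0 j| <= B \/ `|x ord0 j| <= B'.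
- by rewrite in_itv /= -ler_norml le_max => ->.
- by rewrite in_itv /= -ler_norml le_max => ->; rewrite orbT.
have [ui|/hB' /(_ j)] := eqVneq (u i x) 0; last first.
  by rewrite /= in_itv /= -ler_norml; right.
move: h; rewrite ui add0r => /hB /(_ j); rewrite /= in_itv /= -ler_norml; by left.
Qed.

Lemma Cc_L2 n (u : 'rV[R]_n -> R) : Cc u -> @L2 R n u.
Proof.
move=> Cu; have [cu _] := Cu; rewrite /L2 /=; apply/andP; split.
  by rewrite inE /=; exact: continuous_measurable_rV.
rewrite inE /= /finite_norm unlock; apply: poweR_lty.
have Cu2 := CcM Cu cu; have /integrableP[_] := Cc_integrable Cu2.
apply: le_lt_trans; rewrite le_eqVlt; apply/orP; left; apply/eqP.
apply: eq_integral => x _ /=.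
by rewrite powR_mulrn// normrM -expr2.
Qed.

End integration.

(** * Weak derivatives *)

Section partial_derivatives.
Context {R : realType}.
Implicit Types n : nat.

Notation mu n := (@lebesgue_rV R n).

Lemma integral_FTC (f F : R -> R) (a b : R) : a < b -> continuous f ->
  (forall t, f t != 0 -> a <= t <= b) -> (forall t : R, is_derive t 1 F (f t)) ->
  (\int[lebesgue_measure]_t (f t)%:E = (F b - F a)%:E)%E.
Proof.
move=> ab cf fab Ff.
have cF : continuous F.
  move=> y; apply: differentiable_continuous; apply/derivable1_diffP.
  by case: (Ff y).
rewrite (_ : (fun t => _) = (EFin \o f) \_ `[a, b]%classic); last first.
  apply/funext => t; rewrite patchE; case: ifPn => // /negP tab /=.
  by have [->//|/fab h] := eqVneq (f t) 0; case: tab; rewrite inE /= in_itv.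
rewrite -integral_mkcond EFinB; apply: (continuous_FTC2 ab).
- exact: continuous_subspaceT.
- split.
  + by move=> x _; case: (Ff x).
  + exact/cvg_at_right_filter/cF.
  + exact/cvg_at_left_filter/cF.
- by move=> x _; rewrite derive1E; case: (Ff x).
Qed.

Lemma continuous_rV (T : topologicalType) n (g : T -> 'rV[R]_n) :
  (forall i, continuous (fun x => g x ord0 i)) -> continuous g.
Proof.
move=> cg x A [P nP PA].
have h : \forall y \near x, forall i, P ord0 i (g y ord0 i).
  by apply: filter_forall => i; exact: (cg i x _ (nP ord0 i)).
apply: filterS h => y /= h; apply: PA => i j; rewrite ord1; exact: h.
Qed.

Lemma rV_consDZ n (c : R) a b v t :
  rV_cons (c *: a + v, c * b + t) = c *: rV_cons (a, b) + @rV_cons R n (v, t).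
Proof.
have E (p q : 'rV[R]_n.+1) k : (c *: p + q) ord0 k = c * p ord0 k + q ord0 k.
  by rewrite !mxE.
apply/rowP => i; rewrite E; case: (unliftP ord0 i) => [j ->|->].
  by rewrite !rV_consS !mxE.
by rewrite !rV_cons0.
Qed.

Lemma rV_cons_delta n (j : 'I_n) :
  rV_cons (delta_mx ord0 j : 'rV[R]_n, 0) = delta_mx ord0 (lift ord0 j).
Proof.
apply/rowP => i; case: (unliftP ord0 i) => [k ->|->].
  by rewrite rV_consS !mxE !eqxx (inj_eq (@lift_inj _ _)).
by rewrite rV_cons0 !mxE eqxx (negbTE (neq_lift _ _)).
Qed.

Lemma rV_cons_delta0 n : rV_cons (0 : 'rV[R]_n, 1) = delta_mx ord0 ord0.
Proof.
apply/rowP => i; case: (unliftP ord0 i) => [k ->|->].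
  by rewrite rV_consS !mxE.
by rewrite rV_cons0 !mxE.
Qed.

Lemma continuous_rV_cons1 n t : continuous (fun v => @rV_cons R n (v, t)).
Proof.
apply: continuous_rV => i; case: (unliftP ord0 i) => [k ->|->].
  by under eq_fun do rewrite rV_consS; exact: coord_continuous.
by under eq_fun do rewrite rV_cons0; exact: cst_continuous.
Qed.

Lemma continuous_rV_cons2 n v : continuous (fun t => @rV_cons R n (v, t)).
Proof.
apply: continuous_rV => i; case: (unliftP ord0 i) => [k ->|->].
  by under eq_fun do rewrite rV_consS; exact: cst_continuous.
by under eq_fun do rewrite rV_cons0; move=> x; exact: cvg_id.
Qed.

(** Both difference quotients are the same function. This opens coordinate lines to the one-variable
    mean value theorem and fundamental theorem. *)
Lemma is_derive_line n (u : 'rV[R]_n -> R) (x v : 'rV[R]_n) (t : R) :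
  derivable u (t *: v + x) v ->
  is_derive t 1 (fun s => u (s *: v + x)) ('D_v u (t *: v + x)).
Proof.
move=> du.
have E : (fun h : R => h^-1 *: (((fun s => u (s *: v + x)) \o shift t) (h *: 1)
    - u (t *: v + x))) =
  (fun h : R => h^-1 *: ((u \o shift (t *: v + x)) (h *: v) - u (t *: v + x))).
  by apply/funext => h /=; rewrite scalerDl addrA /GRing.scale /= mulr1.
by split; [rewrite /derivable E|rewrite /derive E].
Qed.

(** Outside the closed cube some |x_j| exceeds B, and it still does at nearby points of the line
    through x in direction i; u vanishes there, hence so does its derivative at x. *)
Lemma partial_support n (i : 'I_n) (u : 'rV[R]_n -> R) (B : R) :
  (forall x, derivable u x (delta_mx ord0 i)) ->
  (forall x, u x != 0 -> rbox B x) ->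
  forall x, partial i u x != 0 -> rbox B x.
Proof.
move=> du uB x px j /=; rewrite in_itv /= -ler_norml leNgt; apply/negP => xB.
have := @is_derive_line _ u x (delta_mx ord0 i) 0 (du _).
set F := (fun s => _); set l := 'D_ _ _ _ => dF.
have dF0 : is_derive (0 : R) 1 F 0.
  apply: (@near_eq_is_derive _ _ _ (cst 0)).
  pose G (s : R) : R := `|s * (delta_mx ord0 i : 'rV[R]_n) ord0 j + x ord0 j|.
  have cG : {for (0 : R), continuous G}.
    apply: (@continuous_comp _ _ _ _ (fun y : R => `|y|)).
      apply: continuousD; last exact: cst_continuous.
      by apply: continuousM; [exact: cvg_id|exact: cst_continuous].
    exact: norm_continuous.
  near=> s; have Bs : B < G s.
    by near: s; apply: cvgr_gt cG _ _; rewrite /G mul0r add0r.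
  apply/esym/eqP; rewrite /F; apply: contraT => /uB /(_ j) /=.
  rewrite in_itv /= -ler_norml !mxE leNgt => /negP[].
  by move: Bs; rewrite /G !mxE.
case/negP: px; apply/eqP; have : l = 0.
  by have [_ h1] := dF; have [_ h2] := dF0; exact: (etrans (esym h1) h2).
by rewrite /l scale0r add0r.
Unshelve. all: by end_near. Qed.

Lemma Cc_partial n (i : 'I_n) (u : 'rV[R]_n -> R) : Cc u ->
  (forall x, derivable u x (delta_mx ord0 i)) -> continuous (partial i u) ->
  Cc (partial i u).
Proof.
by move=> [_ [B uB]] du cp; split => //; exists B; exact: partial_support.
Qed.

(** Induction on the dimension. Along the first coordinate, the inner integral is that of the
    derivative of a function of bounded support. Along any other one, the first coordinate is
    integrated last and the induction hypothesis applies to u with that coordinate frozen. *)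
Lemma integral_partial n (i : 'I_n) (u : 'rV[R]_n -> R) : Cc u ->
  (forall x, derivable u x (delta_mx ord0 i)) -> continuous (partial i u) ->
  (\int[mu n]_x (partial i u x)%:E = 0)%E.
Proof.
elim: n i u => [[]//|n IH] i u Cu du cp.
have Cp := Cc_partial Cu du cp; have ip := Cc_integrable Cp.
have mp : measurable_fun setT (fun x => (partial i u x)%:E).
  by apply/measurable_EFinP; exact: continuous_measurable_rV.
have [cu [B uB]] := Cu.
case: (unliftP ord0 i) => [j ij|i0].
- rewrite integral_rV_consC// integral0_eq// => t _.
  have E v (h : R) : u (h *: delta_mx ord0 i + rV_cons (v, t)) =
      u (rV_cons (h *: delta_mx ord0 j + v, t)).
    rewrite ij -rV_cons_delta -rV_consDZ; congr (u (rV_cons (_, _))).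
    by rewrite mulr0 add0r.
  have E' v : (fun h : R => h^-1 *: (((fun v => u (rV_cons (v, t))) \o shift v)
        (h *: delta_mx ord0 j) - u (rV_cons (v, t)))) =
      (fun h : R => h^-1 *: ((u \o shift (rV_cons (v, t))) (h *: delta_mx ord0 i) -
        u (rV_cons (v, t)))).
    by apply/funext => h /=; rewrite E.
  have pE : partial j (fun v => u (rV_cons (v, t))) =
      fun v => partial i u (rV_cons (v, t)).
    by apply/funext => v; rewrite /partial /derive E'.
  transitivity (\int[mu n]_v (partial j (fun v => u (rV_cons (v, t))) v)%:E)%E.
    by rewrite pE.
  apply: IH.
  + split.
      by move=> v; exact: (continuous_comp (@continuous_rV_cons1 n t v) (cu _)).
    exists B => v /uB h k; have := h (lift ord0 k); by rewrite rV_consS.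
  + by move=> v; rewrite /derivable E'; exact: du.
  + by rewrite pE => v; exact: (continuous_comp (@continuous_rV_cons1 n t v) (cp _)).
- rewrite integral_rV_cons// integral0_eq// => v _.
  have E (t : R) : rV_cons (v, t) = t *: delta_mx ord0 i + rV_cons (v, 0).
    by rewrite i0 -rV_cons_delta0 -rV_consDZ scaler0 add0r mulr1 addr0.
  pose F (t : R) : R := u (rV_cons (v, t)).
  have FE : F = fun t : R => u (t *: delta_mx ord0 i + rV_cons (v, 0)).
    by apply/funext => t; rewrite /F E.
  have dF (t : R) : is_derive t 1 F (partial i u (rV_cons (v, t))).
    by rewrite FE E; apply: is_derive_line.
  have supp (t : R) (w : 'rV[R]_n.+1 -> R) :
      (forall x, w x != 0 -> rbox B x) -> w (rV_cons (v, t)) != 0 -> - B <= t <= B.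
    by move=> wB /wB /(_ ord0); rewrite rV_cons0 /= in_itv.
  have B0 := ler_norm B; have B1 := ler_norm (- B); rewrite normrN in B1.
  (* The endpoints lie strictly outside the support, so F vanishes at both; the absolute value
     covers a negative B. *)
  rewrite (@integral_FTC _ F (- (`|B| + 1)) (`|B| + 1)).
  + have F1 : F (`|B| + 1) = 0.
      by apply/eqP; apply: contraT => /(supp _ _ uB); lra.
    have F2 : F (- (`|B| + 1)) = 0.
      by apply/eqP; apply: contraT => /(supp _ _ uB); lra.
    by rewrite F1 F2 subrr.
  + by have := normr_ge0 B; lra.
  + by move=> t; exact: (continuous_comp (@continuous_rV_cons2 n v t) (cp _)).
  + by move=> t /supp h; have := h (partial_support du uB); lra.
Qed.

End partial_derivatives.

Section weak_derivatives.
Context {R : realType}.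
Implicit Types n k : nat.

Notation mu n := (@lebesgue_rV R n).

(** The two sides differ by the integral of the i-th derivative of the product u v, which is zero by
    [integral_partial]. *)
Lemma integral_by_parts n (i : 'I_n) (u v : 'rV[R]_n -> R) :
  Cc u -> (forall x, derivable u x (delta_mx ord0 i)) ->
  continuous (partial i u) ->
  continuous v -> (forall x, derivable v x (delta_mx ord0 i)) ->
  continuous (partial i v) ->
  \int[mu n]_x (u x * partial i v x) = - \int[mu n]_x (partial i u x * v x).
Proof.
move=> Cu du cdu cv dv cdv.
have Cp := Cc_partial Cu du cdu.
have I1 := Cc_integrable (CcM Cu cdv); have I2 := Cc_integrable (CcM Cp cv).
apply/eqP; rewrite -addr_eq0 -RintegralD//; apply/eqP.
have Cuv := CcM Cu cv.
have pE : partial i (fun x => u x * v x) =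
    fun x => u x * partial i v x + partial i u x * v x.
  apply/funext => x; rewrite /partial.
  by rewrite (@deriveM _ _ u v)// /GRing.scale /= [v x * _]mulrC.
have duv x : derivable (fun x => u x * v x) x (delta_mx ord0 i).
  exact: (@derivableM _ _ u v).
have cp : continuous (partial i (fun x => u x * v x)).
  have [cu _] := Cu; rewrite pE => x.
  exact: (continuousD (continuousM (cu x) (cdv x)) (continuousM (cdu x) (cv x))).
by have := integral_partial Cuv duv cp; rewrite pE /Rintegral => ->.
Qed.

(** [smooth] asks for derivatives of all orders; the splines have only two continuous ones, so the
    order is counted here. *)
Fixpoint Ck n k (u : 'rV[R]_n -> R) : Prop :=
  continuous u /\
  if k is k'.+1 then forall i, (forall x, derivable u x (delta_mx ord0 i)) /\
    Ck k' (partial i u) else True.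

Lemma Ck_continuous n k (u : 'rV[R]_n -> R) : Ck k u -> continuous u.
Proof. by case: k => [|k] []. Qed.

Lemma iter_partial_rcons n (s : seq 'I_n) i (u : 'rV[R]_n -> R) :
  iter_partial (rcons s i) u = iter_partial s (partial i u).
Proof. by rewrite /iter_partial foldr_rcons. Qed.

Lemma Cc_iter_partial n (s : seq 'I_n) (u : 'rV[R]_n -> R) :
  Cc u -> Ck (size s) u -> Cc (iter_partial (rev s) u).
Proof.
elim: s u => [|i s IH] u Cu //= [_ /(_ i) [du Cp]].
rewrite rev_cons iter_partial_rcons; apply: IH => //.
by apply: Cc_partial => //; exact: Ck_continuous Cp.
Qed.

(** The outermost derivative of phi is moved first and becomes the innermost one of u, hence [rev];
    symmetry of mixed derivatives is never invoked. *)
Lemma integral_iter_partial n (s : seq 'I_n) (u phi : 'rV[R]_n -> R) :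
  Cc u -> Ck (size s) u -> smooth phi ->
  \int[mu n]_x (u x * iter_partial s phi x) =
  (-1) ^+ size s * \int[mu n]_x (iter_partial (rev s) u x * phi x).
Proof.
elim: s u => [|i s IH] u Cu /=; first by rewrite expr0 mul1r.
move=> [_ /(_ i) [du Cp]] sphi; have [cphi dphi] := sphi s.
have cp := Ck_continuous Cp.
rewrite integral_by_parts//; last by have [] := sphi (i :: s).
rewrite IH//; last exact: Cc_partial.
by rewrite rev_cons iter_partial_rcons exprS mulN1r mulNr.
Qed.

Definition multi_index n (alpha : 'I_n -> nat) : seq 'I_n :=
  flatten [seq nseq (alpha i) i | i <- enum 'I_n].

Lemma size_multi_index n (alpha : 'I_n -> nat) :
  size (multi_index alpha) = order_of alpha.
Proof.
rewrite /multi_index /order_of size_flatten /shape -map_comp sumnE big_map.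
by rewrite big_enum; apply: eq_bigr => i _; rewrite /= size_nseq.
Qed.

(** The multi-index k e_i: k = 1 serves the weak gradient, k = 2 the bound on the pure second
    derivatives of V. *)
Lemma multi_index_nseq n k (i : 'I_n) :
  multi_index (fun j => k * (j == i))%N = nseq k i.
Proof.
suff H (s : seq 'I_n) :
    flatten [seq nseq (k * (j == i)) j | j <- s] = nseq (k * count_mem i s) i.
  by rewrite /multi_index H count_uniq_mem ?enum_uniq// mem_enum muln1.
elim: s => [|j s IH] /=; first by rewrite muln0.
rewrite IH; case: eqVneq => [->|_]; last by rewrite muln0.
by rewrite muln1 mulnDr muln1 nseqD.
Qed.

Lemma Ck_le n k l (u : 'rV[R]_n -> R) : (k <= l)%N -> Ck l u -> Ck k u.
Proof.
elim: l k u => [|l IH] [|k] u //= kl [cu H]; split=> // i.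
by have [du Cp] := H i; split=> //; exact: IH Cp.
Qed.

Lemma Ck_weak_derivative n (alpha : 'I_n -> nat) (u : 'rV[R]_n -> R) :
  Cc u -> Ck (order_of alpha) u ->
  L2 (iter_partial (rev (multi_index alpha)) u) /\
  weak_derivative alpha u (iter_partial (rev (multi_index alpha)) u).
Proof.
rewrite -size_multi_index => Cu Cku; split.
  by apply: Cc_L2; exact: Cc_iter_partial.
by move=> phi [sphi _]; rewrite -size_multi_index; exact: integral_iter_partial.
Qed.

Lemma Ck2_H2 n (u : 'rV[R]_n -> R) : Cc u -> Ck 2 u ->
  H2 u /\ weak_gradient u (fun i => partial i u).
Proof.
move=> Cu Cku; split.
  split; first exact: Cc_L2.
  move=> alpha a2; have [] := @Ck_weak_derivative _ alpha u Cu.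
    exact: Ck_le Cku.
  by move=> ? ?; eexists; eauto.
move=> i; have := @Ck_weak_derivative _ (fun j => (j == i)%N) u Cu.
rewrite (_ : (fun j => (j == i : nat)) = (fun j => 1 * (j == i))%N); last first.
  by apply/funext => j; rewrite mul1n.
rewrite multi_index_nseq -size_multi_index multi_index_nseq; apply.
exact: Ck_le Cku.
Qed.

Lemma Ck_lin n k (a : R) (u v : 'rV[R]_n -> R) : Ck k u -> Ck k v ->
  Ck k (fun x => a * u x + v x).
Proof.
elim: k u v => [|k IH] u v /= [cu Hu] [cv Hv].
  split=> // x.
  exact: (continuousD (continuousM (@cst_continuous _ _ a _) (cu x)) (cv x)).
split.
  move=> x.
  exact: (continuousD (continuousM (@cst_continuous _ _ a _) (cu x)) (cv x)).
move=> i; have [du Cu] := Hu i; have [dv Cv] := Hv i; split.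
  by move=> x; apply: (@derivableD _ _ _ (a \*: u) v) => //; exact: derivableZ.
rewrite (_ : partial i _ = (fun x => a * partial i u x + partial i v x)).
  exact: IH.
apply/funext => x; rewrite /partial (@deriveD _ _ _ (a \*: u) v)//.
  by rewrite deriveZ.
exact: derivableZ.
Qed.

Lemma Ck_cst n k (c : R) : Ck k (fun _ : 'rV[R]_n => c).
Proof.
elim: k c => [|k IH] c /=; split=> //; try exact: cst_continuous.
move=> i; split; first by move=> x; exact: (@derivable_cst _ _ _ c).
rewrite (_ : partial i _ = (fun _ => 0)); first exact: IH.
by apply/funext => x; rewrite /partial; exact: (@derive_cst _ _ _ c).
Qed.

Lemma Ck_sum n k (I : Type) (s : seq I) (c : I -> R) (u : I -> 'rV[R]_n -> R) :
  (forall j, Ck k (u j)) -> Ck k (fun x => \sum_(j <- s) c j * u j x).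
Proof.
move=> Cu; elim: s => [|j s IH].
  under eq_fun do rewrite big_nil; exact: Ck_cst.
by under eq_fun do rewrite big_cons; exact: Ck_lin.
Qed.

Lemma partial_sum n (i : 'I_n) (I : Type) (s : seq I) (c : I -> R)
    (u : I -> 'rV[R]_n -> R) :
  (forall j x, derivable (u j) x (delta_mx ord0 i)) ->
  partial i (fun x => \sum_(j <- s) c j * u j x) =
  fun x => \sum_(j <- s) c j * partial i (u j) x.
Proof.
move=> du; apply/funext => x; suff [_ h] : is_derive x (delta_mx ord0 i)
  (fun x => \sum_(j <- s) c j * u j x) (\sum_(j <- s) c j * partial i (u j) x).
  by rewrite /partial h.
elim: s => [|j s IH].
  under eq_fun do rewrite big_nil; rewrite big_nil; exact: (is_derive_cst (0 : R^o)).
under eq_fun do rewrite big_cons; rewrite big_cons.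
apply: (@is_deriveD _ _ _ (c j \*: u j)); apply: is_deriveZ.
exact: DeriveDef.
Qed.

Definition update n (h : 'I_n -> R -> R) (i : 'I_n) (h' : R -> R) : 'I_n -> R -> R :=
  fun j => if j == i then h' else h j.

Lemma is_derive_tensor n (h : 'I_n -> R -> R) (i : 'I_n) (h' : R -> R) x :
  (forall t : R, is_derive t 1 (h i) (h' t)) ->
  is_derive x (delta_mx ord0 i) (tensor h) (tensor (update h i h') x).
Proof.
move=> hh'.
(* The factors other than the i-th; they are constant along direction i. *)
pose T (y : 'rV[R]_n) := \prod_(j < n | j != i) h j (y ord0 j).
have hT y : tensor h y = T y * h i (y ord0 i).
  by rewrite /tensor (bigD1 i)//= mulrC.
have h'T : tensor (update h i h') x = T x * h' (x ord0 i).
  rewrite /tensor (bigD1 i)//= mulrC /update eqxx; congr (_ * _).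
  by apply: eq_bigr => j /negbTE ->.
have Ts s : T (s *: delta_mx ord0 i + x) = T x.
  by apply: eq_bigr => j ji; rewrite !mxE (negbTE ji) andbF mulr0 add0r.
have E : (fun s : R => s^-1 *: ((tensor h \o shift x) (s *: delta_mx ord0 i)
    - tensor h x)) =
  (fun s : R => s^-1 *: (((T x \*: h i) \o shift (x ord0 i)) (s *: 1)
    - (T x \*: h i) (x ord0 i))).
  apply/funext => s /=; rewrite !hT Ts /GRing.scale /=.
  by rewrite !mxE !eqxx mulr1.
have [d1 d2] := is_deriveZ (T x) (hh' (x ord0 i)).
split; first by rewrite /derivable E.
by rewrite /derive E; exact: (etrans d2 (esym h'T)).
Qed.

Fixpoint C1k k (h : R -> R) : Prop :=
  continuous h /\ if k is k'.+1 then
    exists2 h', (forall t : R, is_derive t 1 h (h' t)) & C1k k' h' else True.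

Lemma C1k_continuous k h : C1k k h -> continuous h.
Proof. by case: k => [|k] []. Qed.

Lemma C1kS k h : C1k k.+1 h -> C1k k h.
Proof.
elim: k h => [|k IH] h [ch [h' hh' Ch']]; split=> //.
by exists h' => //; exact: IH.
Qed.

Lemma Ck_tensor n k (h : 'I_n -> R -> R) :
  (forall i, C1k k (h i)) -> Ck k (tensor h).
Proof.
elim: k h => [|k IH] h Ch /=; split=> //;
  try by apply: continuous_tensor => i; exact: C1k_continuous (Ch i).
move=> i; have [_ [h' hh' Ch']] := Ch i; split.
  by move=> x; have [] := is_derive_tensor x hh'.
rewrite (_ : partial i _ = tensor (update h i h')).
  by apply: IH => j; rewrite /update; case: ifP => // _; exact: C1kS.
by apply/funext => x; have [_ <-] := is_derive_tensor x hh'.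
Qed.

Lemma Cc_tensor n (h : 'I_n -> R -> R) (B : R) : (forall i, continuous (h i)) ->
  (forall i t, h i t != 0 -> - B <= t <= B) -> Cc (tensor h).
Proof.
move=> ch hB; split; first exact: continuous_tensor.
exists B => x /prodf_neq0 h0 i /=; rewrite in_itv /=.
by apply: (hB i); exact: h0.
Qed.

End weak_derivatives.

(** * Sums over the lattice *)

Section lattice_sums.
Context {R : realType} {d : nat}.
Implicit Types (c : 'rV[int]_d -> R) (n k : 'rV[int]_d).

Definition lsum c : \bar R := \esum_(k in [set: 'rV[int]_d]) (c k)%:E.

Lemma lsum_ge0 c : (forall k, 0 <= c k) -> (0 <= lsum c)%E.
Proof. by move=> c0; apply: esum_ge0 => k _; rewrite lee_fin. Qed.

Lemma le_lsum c c' : (forall k, c k <= c' k) -> (lsum c <= lsum c')%E.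
Proof. by move=> cc'; apply: le_esum => k _; rewrite lee_fin. Qed.

Lemma lsumD c c' : (forall k, 0 <= c k) -> (forall k, 0 <= c' k) ->
  lsum (fun k => c k + c' k) = (lsum c + lsum c')%E.
Proof.
move=> c0 c'0; rewrite /lsum -esumD//; last 2 first.
- by move=> k _; rewrite lee_fin.
- by move=> k _; rewrite lee_fin.
Qed.

Lemma lsum_sum (I : Type) (s : seq I) (u : I -> 'rV[int]_d -> R) :
  (forall i k, 0 <= u i k) ->
  lsum (fun k => \sum_(i <- s) u i k) = (\sum_(i <- s) lsum (u i))%E.
Proof.
move=> u0; elim: s => [|i s IH].
  by rewrite big_nil; apply: esum1 => k _; rewrite big_nil.
rewrite big_cons -IH -lsumD//; last by move=> k; exact: sumr_ge0.
by congr lsum; apply/funext => k; rewrite big_cons.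
Qed.

Lemma lsum_shift c n : lsum (fun k => c (k + n)) = lsum c.
Proof.
rewrite /lsum [RHS](reindex_esum setT setT (fun k => k + n))//.
split => // [k l _ _ /addIr//|k _]; by exists (k - n) => //; rewrite subrK.
Qed.

Lemma lsum_seq (s : seq 'rV[int]_d) c : uniq s -> (forall k, 0 <= c k) ->
  (forall k, c k != 0 -> k \in s) -> lsum c = (\sum_(k <- s) c k)%:E.
Proof.
move=> us c0 cs; transitivity (\esum_(k in [set` s]) (c k)%:E).
  rewrite [RHS]esum_mkcond; apply: eq_esum => k _; case: ifPn => // /negP ks.
  by have [->//|/cs kk] := eqVneq (c k) 0; case: ks; rewrite inE.
rewrite esum_fset; last 2 first.
- exact: finite_seq.
- by move=> k _; rewrite lee_fin.
by rewrite -fsbig_seq// sumEFin.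
Qed.

Definition difference_energy c n : \bar R := lsum (fun k => (c (k + n) - c k) ^+ 2).

(** Literally the first sum of [discrete_energy], so that the two are convertible. *)
Definition kinetic c : \bar R :=
  \esum_(e in [set: 'rV[int]_d * 'I_d])
     ((c (e.1 + delta_mx ord0 e.2)%R - c e.1) ^+ 2)%:E.

Lemma difference_energy_ge0 c n : (0 <= difference_energy c n)%E.
Proof. by apply: lsum_ge0 => k; exact: sqr_ge0. Qed.

Lemma kineticE c : kinetic c = (\sum_(i < d) difference_energy c (delta_mx ord0 i))%E.
Proof.
rewrite /difference_energy -lsum_sum; last by move=> i k; exact: sqr_ge0.
rewrite /lsum.
under eq_esum do rewrite -sumEFin.
transitivity (\esum_(k in [set: 'rV[int]_d]) \esum_(i in [set: 'I_d])
    ((c (k + delta_mx ord0 i) - c k) ^+ 2)%:E).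
  rewrite (@esum_esum _ _ _ _ (fun=> setT)).
    by rewrite /kinetic; congr esum; apply/seteqP; split.
  by move=> *; rewrite lee_fin sqr_ge0.
apply: eq_esum => k _; rewrite esum_fset; last 2 first.
- exact: finite_finset.
- by move=> i _; rewrite lee_fin sqr_ge0.
rewrite (_ : [set: 'I_d] = [set` index_enum 'I_d]).
  by rewrite -fsbig_seq// index_enum_uniq.
by apply/seteqP; split => // i _; rewrite /= mem_index_enum.
Qed.

Lemma kinetic_ge0 c : (0 <= kinetic c)%E.
Proof. by apply: esum_ge0 => e _; rewrite lee_fin sqr_ge0. Qed.

Lemma difference_energyN c n : difference_energy c (- n) = difference_energy c n.
Proof.
rewrite /difference_energy -[LHS](lsum_shift _ n); congr lsum.
by apply/funext => k; rewrite addrK -[in RHS]sqrrN opprB.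
Qed.

(** The increment along n1 + n2 is the sum of two increments p and q, and (p + q)^2 <= 2 p^2 + 2
    q^2; the energy along n2 is first translated by n1. *)
Lemma difference_energyD c n1 n2 :
  (difference_energy c (n1 + n2) <=
   (difference_energy c n1 + difference_energy c n1) +
   (difference_energy c n2 + difference_energy c n2))%E.
Proof.
have sq n k : 0 <= (c (k + n) - c k) ^+ 2 by exact: sqr_ge0.
have -> : difference_energy c n2 =
    lsum (fun k => (c (k + n1 + n2) - c (k + n1)) ^+ 2).
  exact: (esym (lsum_shift (fun k => (c (k + n2) - c k) ^+ 2) n1)).
rewrite /difference_energy -!lsumD//.
- apply: le_lsum => k; rewrite addrA -subr_ge0.
  set x := c _; set y := c _; set z := c _.
  rewrite [leRHS](_ : _ = ((x - y) - (z - x)) ^+ 2); first exact: sqr_ge0.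
  by ring.
- by move=> k; rewrite addr_ge0.
- by move=> k; rewrite addr_ge0 ?sqr_ge0.
Qed.

(* The shifts n satisfying the bound form a subgroup of Z^d containing the
   coordinate vectors. *)
Lemma difference_energy_le_kinetic n : exists2 C : R, 0 <= C &
  forall c, (difference_energy c n <= C%:E * kinetic c)%E.
Proof.
pose P n := exists2 C : R, 0 <= C &
  forall c, (difference_energy c n <= C%:E * kinetic c)%E.
have P0 : P 0.
  exists 0 => // c; rewrite mul0e /difference_energy /lsum esum1// => k _.
  by rewrite addr0 subrr expr0n.
have PN a : P a -> P (- a).
  by move=> [C C0 h]; exists C => // c; rewrite difference_energyN.
have PD a b : P a -> P b -> P (a + b).
  move=> [C C0 hC] [C' C'0 hC']; exists ((C + C) + (C' + C')).
    by rewrite !addr_ge0.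
  move=> c; apply: (le_trans (difference_energyD c a b)).
  rewrite EFinD ge0_muleDl ?lee_fin ?addr_ge0//.
  rewrite !EFinD !ge0_muleDl ?lee_fin//.
  by rewrite !leeD.
have Pe i : P (delta_mx ord0 i).
  exists 1 => // c; rewrite mul1e kineticE (bigD1 i)//= leeDl// sume_ge0// => j _.
  exact: difference_energy_ge0.
have PZ (z : int) a : P a -> P (z *: a).
  move=> Pa; elim/int_ind : z => [|m IH|m IH]; first by rewrite scale0r.
    by rewrite intS scalerDl scale1r; exact: PD.
  by rewrite intS opprD scalerDl scaleN1r; apply: PD => //; exact: PN.
rewrite -/(P n) (row_sum_delta n); elim/big_ind : _ => // i _; exact: PZ.
Qed.

End lattice_sums.

(** * Weighted averages over windows of 4^d lattice points *)

Section window_averages.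
Context {R : realType} {d : nat}.
Implicit Types (c : 'rV[int]_d -> R) (k : 'rV[int]_d) (x : 'rV[R]_d).
Implicit Types (h : 'I_d -> R -> R) (theta : R).

Local Notation window := {ffun 'I_d -> 'I_4}.

Definition offset (F : window) : 'rV[int]_d := \row_i (F i : nat)%:Z.

Definition corner theta x : 'rV[int]_d := \row_i Num.floor (x ord0 i / theta).

Definition weight theta h k : 'rV[R]_d -> R :=
  tensor (fun i t => h i (t / theta - (k ord0 i)%:~R)).

(** The sum ranges over the only lattice points whose weight at x can be nonzero. Indexing them by a
    fixed finite type makes it a convex combination with finitely many terms for any c, ready for
    Jensen; [averageE] recovers a sum over the support of c, with terms continuous in x. *)
Definition average theta h c x : R :=
  \sum_(F : window) weight theta h (corner theta x - offset F) x *
    c (corner theta x - offset F).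

Lemma weight_ge0 theta h k x : (forall i, profile (h i)) -> 0 <= weight theta h k x.
Proof. by move=> kh; apply: tensor_ge0 => i t; exact: profile_ge0. Qed.

(** Distributivity turns the sum of products into a product over the coordinates of one-variable
    partitions of unity, each taken at the fractional part of x_i / theta. *)
Lemma sum_weight theta h x : (forall i, profile (h i)) ->
  \sum_(F : window) weight theta h (corner theta x - offset F) x = 1.
Proof.
move=> kh.
pose u i := x ord0 i / theta - (Num.floor (x ord0 i / theta))%:~R.
transitivity (\sum_(F : window) \prod_i h i (u i + (F i : nat)%:R)).
  apply: eq_bigr => F _; apply: eq_bigr => i _; congr (h i _).
  by rewrite !mxE intrB /u opprB addrA addrAC.
rewrite -(bigA_distr_bigA (fun i (j : 'I_4) => h i (u i + (j : nat)%:R))).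
rewrite big1// => i _; apply: profile_unit => //.
have /andP[h1 h2] := floor_itv (x ord0 i / theta).
by rewrite /u subr_ge0 h1 /= ltrBlDr addrC -[X in _ + X]/(1%:~R) -intrD.
Qed.

Lemma weight_window theta h k x : (forall i, profile (h i)) ->
  weight theta h k x != 0 -> exists F : window, k = corner theta x - offset F.
Proof.
move=> kh /prodf_neq0 hk.
have kb i : k ord0 i <= Num.floor (x ord0 i / theta) < k ord0 i + 4.
  have /andP[h1 h2] := profile_supp (kh i) (hk i isT).
  rewrite floor_ge_int floor_lt_int intrD; apply/andP; split; lra.
exists [ffun i => inord `|Num.floor (x ord0 i / theta) - k ord0 i|%N].
apply/rowP => i; have /andP[h1 h2] := kb i; rewrite !mxE ffunE inordK.
  by rewrite gez0_abs ?subr_ge0// opprB addrC subrK.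
by rewrite -ltz_nat gez0_abs ?subr_ge0// ltrBlDr addrC.
Qed.

Lemma offset_inj : injective offset.
Proof.
move=> F G /rowP FG; apply/ffunP => i; apply/val_inj.
by have := FG i; rewrite !mxE => -[].
Qed.

Lemma eq_sum_support (I : choiceType) (s t : seq I) (u : I -> R) :
  uniq s -> uniq t -> (forall i, u i != 0 -> i \in s) ->
  (forall i, u i != 0 -> i \in t) -> \sum_(i <- s) u i = \sum_(i <- t) u i.
Proof.
move=> us ut hs ht; rewrite !bigfs// => i _.
- by apply: contraNeq => /ht.
- by apply: contraNeq => /hs.
Qed.

Lemma averageE theta h c (s : seq 'rV[int]_d) : (forall i, profile (h i)) ->
  uniq s -> (forall k, c k != 0 -> k \in s) ->
  average theta h c = fun x => \sum_(k <- s) c k * weight theta h k x.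
Proof.
move=> kh us cs; apply/funext => x.
pose t := [seq corner theta x - offset F | F <- enum {: window}].
transitivity (\sum_(k <- t) c k * weight theta h k x).
  rewrite /t big_map big_enum /= /average.
  by apply: eq_bigr => F _; rewrite mulrC.
apply: eq_sum_support => //.
- rewrite map_inj_uniq ?enum_uniq// => F G /addrI /oppr_inj; exact: offset_inj.
- move=> k; rewrite mulf_eq0 negb_or => /andP[_ /(weight_window kh)[F ->]].
  by apply/mapP; exists F => //; rewrite mem_enum.
- by move=> k; rewrite mulf_eq0 negb_or => /andP[/cs].
Qed.

Lemma continuous_affine (g : R -> R) (a z : R) : continuous g ->
  continuous (fun t : R => g (t / a - z)).
Proof.
move=> cg t; have c1 : {for t, continuous (fun t : R => t / a - z)}.
  apply: continuousB; last exact: cst_continuous.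
  by apply: continuousM; last exact: cst_continuous.
by apply: (continuous_comp c1); exact: cg.
Qed.

Lemma continuous_weight theta h k : (forall i, profile (h i)) ->
  continuous (weight theta h k).
Proof.
move=> kh; apply: continuous_tensor => i.
exact/continuous_affine/profile_cont.
Qed.

Lemma integral_profile (g : R -> R) theta (z : R) : profile g -> 0 < theta ->
  (\int[lebesgue_measure]_t (g (t / theta - z))%:E = theta%:E)%E.
Proof.
move=> kg t0; have [G [dG G0 G1]] := profile_prim kg.
have tn := lt0r_neq0 t0.
pose F (t : R) := theta * G (t / theta - z).
have dF (t : R) : is_derive t 1 F (g (t / theta - z)).
  have d1 : is_derive t 1 (fun t : R => t / theta - z) theta^-1.
    rewrite (_ : (fun _ => _) = (theta^-1 \*: id) - cst z); last first.
      by apply/funext => s /=; rewrite !fctE /= mulrC.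
    by apply: is_derive_eq; rewrite subr0 /GRing.scale /= mulr1.
  have d2 := @is_derive1_comp _ G _ t _ _ (dG _) d1.
  have d3 := is_deriveZ theta d2.
  rewrite (_ : g _ = theta *: (g (t / theta - z) * theta^-1)) //.
  by rewrite /GRing.scale /= [RHS]mulrC divfK.
rewrite (@integral_FTC _ _ F (theta * z) (theta * (z + 4))) /F.
- rewrite ![theta * (_ : R) / _]mulrAC mulfV// !mul1r subrr G0 mulr0 subr0.
  by rewrite [z + 4]addrC addrK G1 mulr1.
- by rewrite ltr_pM2l// ltrDl.
- exact/continuous_affine/profile_cont.
- move=> t /(profile_supp kg)/andP[h1 h2].
  apply/andP; split; rewrite mulrC.
    by rewrite -ler_pdivlMr//; lra.
  by rewrite -ler_pdivrMr//; lra.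
Qed.

Lemma integral_weight theta h k : (forall i, profile (h i)) -> 0 < theta ->
  (\int[@lebesgue_rV R d]_x (weight theta h k x)%:E = (theta ^+ d)%:E)%E.
Proof.
move=> kh t0; rewrite (@integral_tensor _ _ _ (fun=> theta)).
- by rewrite prodr_const card_ord.
- by move=> i; exact/continuous_affine/profile_cont.
- by move=> i t; exact: profile_ge0.
- by move=> i; exact: integral_profile.
Qed.

Lemma integral_average theta h c (s : seq 'rV[int]_d) : (forall i, profile (h i)) ->
  0 < theta -> (forall k, c k != 0 -> k \in s) -> (forall k, 0 <= c k) ->
  (\int[@lebesgue_rV R d]_x (average theta h c x)%:E = (theta ^+ d)%:E * lsum c)%E.
Proof.
move=> kh t0 cs c0.
have cs' k : c k != 0 -> k \in undup s by rewrite mem_undup; exact: cs.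
rewrite (averageE theta kh (undup_uniq s) cs') (lsum_seq (undup_uniq s) c0 cs').
under eq_integral do rewrite -sumEFin.
rewrite ge0_integral_sum//; last 2 first.
- move=> k; apply/measurable_EFinP; apply: measurable_funM => //.
  by apply: continuous_measurable_rV; exact: continuous_weight.
- by move=> k x _; rewrite lee_fin mulr_ge0// weight_ge0.
rewrite -EFinM mulr_sumr -sumEFin; apply: eq_bigr => k _.
under eq_integral do rewrite EFinM.
rewrite ge0_integralZl//; first by rewrite integral_weight// -EFinM mulrC.
- apply/measurable_EFinP.
  by apply: continuous_measurable_rV; exact: continuous_weight.
- by move=> x _; rewrite lee_fin weight_ge0.
- by rewrite lee_fin.
Qed.

(** Mean of squares = square of the mean + variance. Dropping the variance gives Jensen; estimating
    it gives [average_sqr_le]. *)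
Lemma sum_sqr_convex (I : finType) (p u : I -> R) : (forall i, 0 <= p i) ->
  \sum_i p i = 1 ->
  \sum_i p i * u i ^+ 2 =
  (\sum_i p i * u i) ^+ 2 + \sum_i p i * (u i - \sum_j p j * u j) ^+ 2.
Proof.
move=> p0 p1; set m := \sum_i p i * u i.
rewrite (eq_bigr (fun i => (p i * u i ^+ 2 - 2 * m * (p i * u i)) + m ^+ 2 * p i)
  (F1 := fun i => p i * (u i - m) ^+ 2)); last by move=> i _; ring.
rewrite big_split sumrB /= -!mulr_sumr p1 -/m; ring.
Qed.

Lemma jensen_sqr (I : finType) (p u : I -> R) : (forall i, 0 <= p i) ->
  \sum_i p i = 1 -> (\sum_i p i * u i) ^+ 2 <= \sum_i p i * u i ^+ 2.
Proof.
move=> p0 p1; rewrite (sum_sqr_convex u p0 p1) lerDl; apply: sumr_ge0 => i _.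
by rewrite mulr_ge0// sqr_ge0.
Qed.

Lemma average_jensen theta h c x : (forall i, profile (h i)) ->
  average theta h c x ^+ 2 <= average theta h (fun k => c k ^+ 2) x.
Proof.
move=> kh; apply: jensen_sqr; last exact: sum_weight.
by move=> F; exact: weight_ge0.
Qed.

(** A bound for the variance that depends on the lattice point k alone: as the position of k inside
    the window of x varies with x, all positions are summed. *)
Definition oscillation c k : R := \sum_(FG : window * window)
  (c (k + (offset FG.1 - offset FG.2)) - c k) ^+ 2.

(** The deviation of c from its mean m is itself an average of differences between window points, so
    Jensen and weights at most 1 bound its square by [oscillation]. *)
Lemma average_sqr_le theta h c x : (forall i, profile (h i)) ->
  average theta h (fun k => c k ^+ 2) x <=
  average theta h c x ^+ 2 + average theta h (oscillation c) x.
Proof.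
move=> kh; rewrite {1}/average; set q := corner theta x.
pose p F := weight theta h (q - offset F) x.
have p0 F : 0 <= p F by exact: weight_ge0.
have p1 : \sum_F p F = 1 by exact: sum_weight.
rewrite (sum_sqr_convex (fun F => c (q - offset F)) p0 p1) lerD2l.
apply: ler_sum => F _; apply: ler_wpM2l => //.
set m := \sum_j _.
have -> : c (q - offset F) - m =
    \sum_G p G * (c (q - offset F) - c (q - offset G)).
  under eq_bigr do rewrite mulrBr.
  by rewrite sumrB -mulr_suml p1 mul1r.
apply: (le_trans (jensen_sqr _ p0 p1)).
rewrite /oscillation.
(* Of all pairs, those with first component F suffice: at k = q - offset F they compare c k with
   every c (q - offset G). *)
rewrite -(pair_bigA _ (fun F' G => (c (q - offset F + (offset F' - offset G)) -
  c (q - offset F)) ^+ 2)) /= [leRHS](bigD1 F)//=.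
apply: ler_wpDr; first by apply: sumr_ge0 => F' _; apply: sumr_ge0 => G _; exact: sqr_ge0.
apply: ler_sum => G _; rewrite addrA subrK -[in leRHS]sqrrN opprB.
rewrite ler_piMl ?sqr_ge0// -p1 (bigD1 G)//= lerDl; exact: sumr_ge0.
Qed.

(** After exchanging the sums, this is a finite sum of difference energies along fixed shifts. *)
Lemma lsum_oscillation : exists2 C : R, 0 <= C &
  forall c, (lsum (oscillation c) <= C%:E * kinetic c)%E.
Proof.
pose C (FG : window * window) :=
  sval (cid2 (@difference_energy_le_kinetic R d (offset FG.1 - offset FG.2))).
have C0 FG : 0 <= C FG by rewrite /C; case: cid2.
have CP FG c : (difference_energy c (offset FG.1 - offset FG.2) <=
    (C FG)%:E * kinetic c)%E by rewrite /C; case: cid2.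
exists (\sum_FG C FG); first exact: sumr_ge0.
move=> c; rewrite /oscillation lsum_sum; last by move=> i k; exact: sqr_ge0.
rewrite -sumEFin ge0_sume_distrl; last by move=> i _; rewrite lee_fin.
by apply: lee_sum => FG _; exact: CP.
Qed.

End window_averages.

(** * Comparison of the potentials *)

Section potential_growth.
Context {R : realType}.

Lemma MVT0 (f df : R -> R) (s : R) : (forall t : R, is_derive t 1 f (df t)) ->
  exists2 c, `|c| <= `|s| & f s - f 0 = df c * s.
Proof.
move=> fdf.
have cf : continuous f.
  move=> y; apply: differentiable_continuous; apply/derivable1_diffP.
  by case: (fdf y).
have [s0|s0] := leP 0 s.
  have [|c] := @MVT_segment _ f df 0 s s0; first exact: continuous_subspaceT.
  rewrite in_itv /= subr0 => /andP[c0 cs] E; exists c => //.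
  by rewrite !ger0_norm.
have [|c] := @MVT_segment _ f df s 0 (ltW s0); first exact: continuous_subspaceT.
rewrite in_itv /= sub0r => /andP[c0 cs] E; exists c.
  by rewrite !ler0_norm ?lerN2// ltW.
by rewrite -opprB E mulrN opprK.
Qed.

(** The mean value theorem twice; the constant M instead of M / 2 is enough here. *)
Lemma taylor1 (k k1 k2 : R -> R) (M s : R) :
  (forall t : R, is_derive t 1 k (k1 t)) -> (forall t : R, is_derive t 1 k1 (k2 t)) ->
  (forall t, `|k2 t| <= M) -> `|k s - k 0 - k1 0 * s| <= M * s ^+ 2.
Proof.
move=> d1 d2 k2M; have [c cs ->] := MVT0 s d1; rewrite -mulrBl.
have [c' _ ->] := MVT0 c d2; rewrite -mulrA normrM -[s ^+ 2]ger0_norm ?sqr_ge0//.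
apply: ler_pM => //; rewrite normrM normrX expr2.
exact: ler_wpM2r.
Qed.

(* Nonnegativity at the point s' = - s / delta on the other side of 0 bounds
   the first-order term k' 0 * s by delta * k 0, up to O(s ^ 2 / delta). *)
Lemma nonneg_growth (k k1 k2 : R -> R) (M s delta : R) :
  (forall t : R, is_derive t 1 k (k1 t)) -> (forall t : R, is_derive t 1 k1 (k2 t)) ->
  (forall t, `|k2 t| <= M) -> (forall t, 0 <= k t) -> 0 < delta <= 1 ->
  k s <= (1 + delta) * k 0 + 2 * M * s ^+ 2 / delta.
Proof.
move=> d1 d2 k2M k0 /andP[de0 de1].
have M0 : 0 <= M by exact: le_trans (k2M 0).
have dn := lt0r_neq0 de0.
have := taylor1 s d1 d2 k2M; rewrite ler_norml => /andP[_ h1].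
have := taylor1 (- s / delta) d1 d2 k2M; rewrite ler_norml => /andP[_ h2].
have h3 : k1 0 * s <= delta * k 0 + M * s ^+ 2 / delta.
  have := k0 (- s / delta); set a := k _ in h2 * => a0.
  have : k1 0 * s / delta <= k 0 + M * (s / delta) ^+ 2.
    move: h2; rewrite mulNr sqrrN mulrN mulrA => h2; lra.
  rewrite ler_pdivrMr// => /le_trans; apply.
  rewrite le_eqVlt; apply/orP; left; apply/eqP; field; exact: dn.
have h4 : M * s ^+ 2 <= M * s ^+ 2 / delta.
  by rewrite ler_pdivlMr// ler_piMr// mulr_ge0// sqr_ge0.
have -> : 2 * M * s ^+ 2 / delta = M * s ^+ 2 / delta + M * s ^+ 2 / delta.
  by field; exact: dn.
lra.
Qed.

Variables (d : nat) (V : 'rV[R]_d -> R) (M : R).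
Hypotheses (M0 : 0 <= M) (V0 : forall x, 0 <= V x) (sV : smooth V).
Hypothesis VM : forall i x, `|iter_partial [:: i; i] V x| <= M.

Lemma coordinate_growth i x (s delta : R) : 0 < delta <= 1 ->
  V (s *: delta_mx ord0 i + x) <= (1 + delta) * V x + 2 * M * s ^+ 2 / delta.
Proof.
move=> hd; pose e : 'rV[R]_d := delta_mx ord0 i.
have d1 (t : R) : is_derive t 1 (fun t => V (t *: e + x)) (partial i V (t *: e + x)).
  by apply: is_derive_line; have [_ /(_ i)] := sV [::]; exact.
have d2 (t : R) : is_derive t 1 (fun t => partial i V (t *: e + x))
    (iter_partial [:: i; i] V (t *: e + x)).
  by apply: is_derive_line; have [_ /(_ i)] := sV [:: i]; exact.
have := nonneg_growth s d1 d2 (fun t => VM i _) (fun t => V0 _) hd.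
by rewrite /= scale0r add0r.
Qed.

(** The coordinates of x are replaced by those of y one at a time, each by [coordinate_growth]. *)
Lemma potential_growth (tau delta : R) (x y : 'rV[R]_d) : 0 < delta <= 1 ->
  (forall i, `|y ord0 i - x ord0 i| <= tau) ->
  V y <= (1 + 2 ^+ d * delta) * V x + 2 ^+ d * (2 * M * tau ^+ 2 / delta).
Proof.
move=> hd xy; have /andP[de0 de1] := hd.
pose z j : 'rV[R]_d := \row_i if (i < j)%N then y ord0 i else x ord0 i.
set E := 2 * M * tau ^+ 2 / delta.
have E0 : 0 <= E.
  by apply: divr_ge0; [rewrite mulr_ge0 ?sqr_ge0 ?mulr_ge0|exact: ltW].
(* The coefficients solve a -> 2 a + 1 from 0. Since delta <= 1, (1 + delta) (1 + a delta) <= 1 + (2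
   a + 1) delta and (1 + delta) a + 1 <= 2 a + 1. *)
have step j : (j <= d)%N ->
    V (z j) <= (1 + (2 ^+ j - 1) * delta) * V x + (2 ^+ j - 1) * E.
  elim: j => [_|j IH jd].
    rewrite expr0 subrr !mul0r !addr0 mul1r le_eqVlt; apply/orP; left; apply/eqP.
    by congr V; apply/rowP => i; rewrite mxE.
  pose i := Ordinal jd.
  have zS : z j.+1 = (y ord0 i - x ord0 i) *: delta_mx ord0 i + z j.
    apply/rowP => k; rewrite !mxE ltnS leq_eqVlt; have [kj|kj] := eqVneq k i.
      by rewrite kj /= eqxx ltnn mulr1 subrK.
    have -> : (k == j :> nat) = false by apply/negbTE.
    by rewrite /= mulr0 add0r.
  rewrite zS; apply: (le_trans (coordinate_growth _ _ _ hd)).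
  have sq : 2 * M * (y ord0 i - x ord0 i) ^+ 2 / delta <= E.
    apply: ler_wpM2r; first by rewrite invr_ge0 ltW.
    apply: ler_wpM2l; first by rewrite mulr_ge0.
    by have := xy i; rewrite ler_norml => /andP[]; nra.
  have {IH} := IH (ltnW jd); set v := V (z j) => hv.
  have p1 : 1 <= 2 ^+ j :> R by rewrite exprn_ege1// ler1n.
  have h1 : (1 + delta) * v <= (1 + delta) *
      ((1 + (2 ^+ j - 1) * delta) * V x + (2 ^+ j - 1) * E).
    by apply: ler_wpM2l => //; lra.
  have h2 : 0 <= (2 ^+ j - 1) * (1 - delta) * E.
    by apply: mulr_ge0 => //; apply: mulr_ge0; lra.
  have h3 : 0 <= (2 ^+ j - 1) * (1 - delta) * delta * V x.
    apply: mulr_ge0; last exact: V0.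
    by apply: mulr_ge0; [apply: mulr_ge0; lra|lra].
  rewrite (exprS 2 j); move: (2 * M * _ / delta) sq => X sq.
  clearbody E v; move: (2 ^+ j : R) (V x) h1 h2 h3 => p W h1 h2 h3.
  apply: (le_trans (lerD h1 sq)); rewrite -subr_ge0.
  rewrite [leRHS](_ : _ = (p - 1) * (1 - delta) * delta * W +
    (p - 1) * (1 - delta) * E); first exact: addr_ge0.
  by ring.
have -> : y = z d by apply/rowP => i; rewrite mxE ltn_ord.
apply: (le_trans (step d (leqnn d))); rewrite lerD//.
  apply: ler_wpM2r; first exact: V0.
  by rewrite lerD2l; apply: ler_wpM2r; [exact: ltW|rewrite gerBl].
by apply: ler_wpM2r => //; rewrite gerBl.
Qed.

End potential_growth.

(** * Interpolation of lattice functions *)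

Section rayleigh.
Context {R : realType} {d : nat}.
Variables (V : 'rV[R]_d -> R) (theta : R).
Hypotheses (V0 : forall x, 0 <= V x) (cV : continuous V).

Lemma energy_integrand_ge0 (g : 'rV[R]_d -> R) (G : 'I_d -> 'rV[R]_d -> R) x :
  0 <= theta ^+ 2 * (\sum_(i < d) G i x ^+ 2) + V x * g x ^+ 2.
Proof.
apply: addr_ge0; apply: mulr_ge0; rewrite ?sqr_ge0//.
by apply: sumr_ge0 => i _; exact: sqr_ge0.
Qed.

Lemma continuous_energy_ge0 g G : (0 <= continuous_energy V theta g G)%E.
Proof. by apply: integral_ge0 => x _; rewrite lee_fin energy_integrand_ge0. Qed.

Lemma mu_B_ge0 : (0 <= mu_B V theta)%E.
Proof.
by apply: le_ereal_inf_tmp => _ [g [G [_ _ _ ->]]]; exact: continuous_energy_ge0.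
Qed.

Lemma measurable_energy_integrand (g : 'rV[R]_d -> R) (G : 'I_d -> 'rV[R]_d -> R) :
  continuous g -> (forall i, continuous (G i)) ->
  measurable_fun setT (fun x =>
    (theta ^+ 2 * (\sum_(i < d) G i x ^+ 2) + V x * g x ^+ 2)%:E).
Proof.
move=> cg cG; apply/measurable_EFinP; apply: measurable_funD.
  apply: measurable_funM => //; apply: measurable_sum => i.
  by apply: measurable_funX; exact: continuous_measurable_rV.
apply: measurable_funM; first exact: continuous_measurable_rV.
by apply: measurable_funX; exact: continuous_measurable_rV.
Qed.

(** Dividing u by the square root of S makes it admissible, and scales its energy by 1 / S; [Ck2_H2]
    supplies H^2 and the gradient. *)
Lemma mu_B_rayleigh (u : 'rV[R]_d -> R) (S : R) : Cc u -> Ck 2 u -> 0 < S ->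
  (\int[@lebesgue_rV R d]_x (u x ^+ 2)%:E = S%:E)%E ->
  (mu_B V theta * S%:E <= continuous_energy V theta u (fun i => partial i u))%E.
Proof.
move=> Cu Cku S0 uS; pose l := (Num.sqrt S)^-1; pose v x := l * u x.
have l2 : l ^+ 2 * S = 1.
  by rewrite /l exprVn sqr_sqrtr ?ltW// mulVf// lt0r_neq0.
have cu := Ck_continuous Cku.
have du i x : derivable u x (delta_mx ord0 i) by case: Cku => _ /(_ i)[].
have cp i : continuous (partial i u).
  by have [_ /(_ i)[_ Cp]] := Cku; exact: (@Ck_continuous _ _ 1 _ Cp).
have Cv : Cc v.
  rewrite (_ : v = fun x => u x * l); last by apply/funext => x; exact: mulrC.
  by apply: CcM => //; exact: cst_continuous.
have Ckv : Ck 2 v.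
  have -> : v = fun x => l * u x + 0 by apply/funext => x; rewrite addr0.
  exact: (Ck_lin l Cku (@Ck_cst R d 2 0)).
have pv i : partial i v = fun x => l * partial i u x.
  by apply/funext => x; rewrite /partial (@deriveZ _ _ _ u).
have Ev : continuous_energy V theta v (fun i => partial i v) =
    ((l ^+ 2)%:E * continuous_energy V theta u (fun i => partial i u))%E.
  rewrite /continuous_energy -ge0_integralZl//.
  - apply: eq_integral => x _; rewrite -EFinM; congr (_%:E).
    have -> : \sum_(i < d) partial i v x ^+ 2 =
        l ^+ 2 * \sum_(i < d) partial i u x ^+ 2.
      by rewrite mulr_sumr; apply: eq_bigr => i _; rewrite pv exprMn.
    by rewrite /v exprMn mulrDr; congr (_ + _); exact: mulrCA.
  - exact: measurable_energy_integrand.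
  - move=> x _; rewrite lee_fin.
    exact: (energy_integrand_ge0 u (fun i => partial i u)).
  - by rewrite lee_fin sqr_ge0.
have [H2v Gv] := Ck2_H2 Cv Ckv.
have : (mu_B V theta <= (l ^+ 2)%:E *
    continuous_energy V theta u (fun i => partial i u))%E.
  apply: ereal_inf_lbound; exists v, (fun i => partial i v); split => //.
  suff Iv : (\int[@lebesgue_rV R d]_x (`|(EFin \o v) x| `^ 2) = 1)%E.
    by rewrite unlock Iv poweR_EFin powR1.
  transitivity (\int[@lebesgue_rV R d]_x ((l ^+ 2)%:E * (u x ^+ 2)%:E))%E.
    apply: eq_integral => x _ /=.
    by rewrite powR_mulrn// real_normK ?num_real// exprMn EFinM.
  rewrite ge0_integralZl//.
  - by rewrite uS -EFinM l2.
  - apply/measurable_EFinP; apply: measurable_funX.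
    exact: continuous_measurable_rV.
  - by move=> x _; rewrite lee_fin sqr_ge0.
  - by rewrite lee_fin sqr_ge0.
move=> /(lee_wpmul2r (x := S%:E)) H.
apply: (le_trans (H _)); first by rewrite lee_fin ltW.
by rewrite muleAC -EFinM l2 mul1e.
Qed.

End rayleigh.

Section interpolation.
Context {R : realType} {d : nat}.
Variables (theta : R).
Hypothesis theta0 : 0 < theta.

Definition cubics : 'I_d -> R -> R := fun=> cubic_bspline.

(* The weights occurring in the i-th partial derivative of the interpolant. *)
Definition mixed (i : 'I_d) : 'I_d -> R -> R := update cubics i quadratic_bspline.

Lemma cubics_profile i : profile (cubics i).
Proof. exact: cubic_profile. Qed.

Lemma mixed_profile i j : profile (mixed i j).
Proof.
by rewrite /mixed /update; case: ifP => _; [exact: quadratic_profile|exact: cubic_profile].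
Qed.

Lemma is_derive_bpow_affine j n (a z t : R) :
  is_derive t 1 (fun t => a * bpow j n.+2 (t / theta - z))
    (a / theta * bpow j n.+1 (t / theta - z)).
Proof.
have d1 : is_derive t 1 (fun t : R => t / theta - z) theta^-1.
  rewrite (_ : (fun _ => _) = (theta^-1 \*: id) - cst z); last first.
    by apply/funext => s /=; rewrite !fctE /= mulrC.
  by apply: is_derive_eq; rewrite subr0 /GRing.scale /= mulr1.
have d2 := @is_derive1_comp _ (bpow j n.+2) _ t _ _ (is_derive_bpow _ _ _) d1.
have d3 := is_deriveZ a d2.
rewrite (_ : _ * bpow j n.+1 _ = a *: (bpow j n.+1 (t / theta - z) * theta^-1)) //.
by rewrite -[RHS]/(_ * _) mulrA mulrAC.
Qed.

(** The scalar a absorbs the factor 1 / theta that each derivative brings, which keeps the induction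
    within one family. *)
Lemma C1k_bpow_affine k j (a z : R) :
  C1k k (fun t => a * bpow j k.+1 (t / theta - z)).
Proof.
have cb n b : continuous (fun t : R => b * bpow j n (t / theta - z)).
  have c1 := continuous_affine (a := theta) (z := z) (@continuous_bpow R j n).
  by move=> t; exact: (continuousM (@cst_continuous _ _ b _) (c1 t)).
elim: k a => [|k IH] a; split=> //.
exists (fun t => a / theta * bpow j k.+1 (t / theta - z)); last exact: IH.
by move=> t; exact: is_derive_bpow_affine.
Qed.

Lemma Ck_weight k : Ck 2 (weight theta cubics k).
Proof.
apply: Ck_tensor => i; rewrite (_ : (fun _ => _) =
    fun t => 1 * bpow 4 3 (t / theta - (k ord0 i)%:~R)).
  exact: C1k_bpow_affine.
by apply/funext => t; rewrite mul1r.
Qed.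

Lemma Cc_weight k : Cc (weight theta cubics k).
Proof.
(* One bound must serve all coordinates; the sum of the individual bounds dominates each. *)
apply: (@Cc_tensor _ _ _ (\sum_i theta * (`|(k ord0 i)%:~R| + 4))).
  by move=> i; apply: continuous_affine; exact: continuous_bpow.
move=> i t /(profile_supp cubic_profile)/andP[h1 h2].
rewrite -ler_norml (bigD1 i)//=; apply: ler_wpDr.
  by apply: sumr_ge0 => j _; rewrite mulr_ge0// ?ltW// addr_ge0.
rewrite -[t](divfK (lt0r_neq0 theta0)) mulrC normrM gtr0_norm// ler_pM2l//.
have -> : t / theta = (k ord0 i)%:~R + (t / theta - (k ord0 i)%:~R) by ring.
rewrite (le_trans (ler_normD _ _))// lerD2l ger0_norm; lra.
Qed.

(** [bpow 4 2] is [bdiff (bpow 3 2)] by definition, and a unit shift of its argument amounts to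
    replacing k by k + e_i. *)
Lemma partial_weight i k : partial i (weight theta cubics k) =
  fun x => theta^-1 * (weight theta (mixed i) k x -
                       weight theta (mixed i) (k + delta_mx ord0 i) x).
Proof.
apply/funext => x; rewrite /partial.
pose z : R := (k ord0 i)%:~R.
have dh (t : R) : is_derive t 1 (fun t : R => cubic_bspline (t / theta - z))
    (1 / theta * bpow 4 2 (t / theta - z)).
  rewrite (_ : (fun _ => _) = fun t => 1 * bpow 4 3 (t / theta - z)).
    exact: is_derive_bpow_affine.
  by apply/funext => s; rewrite mul1r.
have [_ ->] := @is_derive_tensor _ _
  (fun j t => cubics j (t / theta - (k ord0 j)%:~R)) i _ x dh.
have tD (h : 'I_d -> R -> R) :
    tensor h x = h i (x ord0 i) * \prod_(j < d | j != i) h j (x ord0 j).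
  by rewrite /tensor (bigD1 i).
rewrite /weight !tD /mixed /update !eqxx.
set T := \prod_(j < d | _) _; set T1 := \prod_(j < d | _) _.
set T2 := \prod_(j < d | _) _.
have -> : T1 = T.
  by apply: eq_bigr => j /negbTE ji; rewrite ji.
have -> : T2 = T.
  by apply: eq_bigr => j /negbTE ji; rewrite ji !mxE ji andbF addr0.
rewrite -mulrBl mul1r -mulrA; congr (_ * (_ * _)).
rewrite /quadratic_bspline /= /bdiff; congr (_ - bpow 3 2 _).
by rewrite !mxE !eqxx intrD /z opprD addrA.
Qed.

Variables (c : 'rV[int]_d -> R) (s : seq 'rV[int]_d).
Hypotheses (us : uniq s) (cs : forall k, c k != 0 -> k \in s).

Definition interpolant : 'rV[R]_d -> R := average theta cubics c.

Let interpolantE : interpolant = fun x => \sum_(k <- s) c k * weight theta cubics k x.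
Proof. exact: averageE cubics_profile us cs. Qed.

Lemma Ck_interpolant : Ck 2 interpolant.
Proof. by rewrite interpolantE; apply: Ck_sum => k; exact: Ck_weight. Qed.

Lemma Cc_interpolant : Cc interpolant.
Proof.
rewrite interpolantE; apply: Cc_sum => k.
rewrite (_ : (fun x => _) = fun x => weight theta cubics k x * c k).
  by apply: CcM; [exact: Cc_weight|exact: cst_continuous].
by apply/funext => x; rewrite mulrC.
Qed.

(** Summation by parts: the shift of the weight in [partial_weight] is moved onto c, and theta
    cancels the factor of the chain rule. *)
Lemma partial_interpolant i x : theta * partial i interpolant x =
  average theta (mixed i) (fun k => c k - c (k - delta_mx ord0 i)) x.
Proof.
pose e : 'rV[int]_d := delta_mx ord0 i.
pose c' k := c (k - e).
have c's k : c' k != 0 -> k \in [seq l + e | l <- s].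
  by move=> /cs ks; apply/mapP; exists (k - e) => //; rewrite subrK.
have us' : uniq [seq l + e | l <- s] by rewrite map_inj_uniq// => ? ? /addIr.
transitivity (average theta (mixed i) c x - average theta (mixed i) c' x).
  rewrite (averageE theta (mixed_profile i) us cs).
  rewrite (averageE theta (mixed_profile i) us' c's) big_map interpolantE.
  rewrite partial_sum; last first.
    by move=> k y; have [_ /(_ i)[]] := Ck_weight k.
  rewrite mulr_sumr -sumrB; apply: eq_bigr => k _.
  by rewrite partial_weight /c' addrK mulrCA mulVKf ?lt0r_neq0// mulrBr.
by rewrite /average -sumrB; apply: eq_bigr => F _; rewrite mulrBr.
Qed.

End interpolation.

(** * Energy and norm of the interpolant *)

Section energy_comparison.
Context {R : realType} {d : nat}.
Variables (V : 'rV[R]_d -> R) (M : R).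
Hypotheses (M0 : 0 <= M) (V0 : forall x, 0 <= V x) (sV : smooth V).
Hypothesis VM : forall i x, `|iter_partial [:: i; i] V x| <= M.

Let cV : continuous V. Proof. by have [] := sV [::]. Qed.

Lemma growth_factor_ge0 (delta : R) : 0 < delta -> 0 <= 1 + 2 ^+ d * delta.
Proof.
move=> de0; apply: addr_ge0 => //; apply: mulr_ge0; first exact: exprn_ge0.
exact: ltW.
Qed.

Lemma growth_error_ge0 (delta tau : R) : 0 < delta ->
  0 <= 2 ^+ d * (2 * M * tau ^+ 2 / delta).
Proof.
move=> de0; apply: mulr_ge0; first exact: exprn_ge0.
apply: divr_ge0; last exact: ltW.
by apply: mulr_ge0; [exact: mulr_ge0|exact: sqr_ge0].
Qed.

Lemma weight_support theta (h : 'I_d -> R -> R) k (x : 'rV[R]_d) : 0 < theta ->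
  (forall i, profile (h i)) -> weight theta h k x != 0 ->
  forall i, `|x ord0 i - lattice_point theta k ord0 i| <= 4 * theta.
Proof.
move=> t0 ph /prodf_neq0 hk i.
have /andP[h1 h2] := profile_supp (ph i) (hk i isT).
rewrite !mxE -[x ord0 i](divfK (lt0r_neq0 t0)) [theta * _]mulrC -mulrBl normrM.
by rewrite (gtr0_norm t0) ler_pM2r// ger0_norm ltW.
Qed.

(** Jensen comes first. Then V is compared between x and each lattice point of nonzero weight, at
    most 4 theta away in every coordinate, so that the growth factor falls on the lattice values. *)
Lemma potential_average_le (theta delta : R) (c : 'rV[int]_d -> R) (x : 'rV[R]_d) :
  0 < theta -> 0 < delta <= 1 ->
  V x * average theta cubics c x ^+ 2 <= average theta cubics (fun k =>
    ((1 + 2 ^+ d * delta) * V (lattice_point theta k) +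
     2 ^+ d * (2 * M * (4 * theta) ^+ 2 / delta)) * c k ^+ 2) x.
Proof.
move=> t0 hd.
apply: (le_trans (ler_wpM2l (V0 x) (average_jensen theta c x (@cubics_profile R d)))).
rewrite /average mulr_sumr; apply: ler_sum => F _; set k := _ - _.
rewrite mulrCA.
have [->|wk] := eqVneq (weight theta cubics k x) 0; first by rewrite !mul0r.
apply: ler_wpM2l; first exact: (weight_ge0 _ _ _ (@cubics_profile R d)).
apply: ler_wpM2r; first exact: sqr_ge0.
apply: (potential_growth M0 V0 sV VM hd).
exact: (weight_support t0 (@cubics_profile R d)).
Qed.

Lemma measurable_average theta h (c : 'rV[int]_d -> R) s :
  (forall i, profile (h i)) -> uniq s -> (forall k, c k != 0 -> k \in s) ->
  measurable_fun setT (fun x : 'rV[R]_d => (average theta h c x)%:E).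
Proof.
move=> ph us cs; apply/measurable_EFinP; rewrite (averageE theta ph us cs).
apply: measurable_sum => k; apply: measurable_funM => //.
by apply: continuous_measurable_rV; exact: continuous_weight.
Qed.

Lemma average_ge0 theta h (c : 'rV[int]_d -> R) x : (forall i, profile (h i)) ->
  (forall k, 0 <= c k) -> 0 <= average theta h c x :> R.
Proof.
by move=> ph c0; apply: sumr_ge0 => F _; rewrite mulr_ge0// weight_ge0.
Qed.

(** The energy density is bounded pointwise by averages, with weights [mixed i] for the i-th
    derivative and [cubics] for the potential; each weight integrates to theta ^ d, whatever its
    profiles. *)
Lemma interpolant_energy_le (theta delta : R) (c : 'rV[int]_d -> R) s :
  0 < theta -> 0 < delta <= 1 -> uniq s -> (forall k, c k != 0 -> k \in s) ->
  (continuous_energy V theta (interpolant theta c)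
      (fun i => partial i (interpolant theta c)) <=
   (theta ^+ d)%:E * (kinetic c + lsum (fun k =>
     ((1 + 2 ^+ d * delta) * V (lattice_point theta k) +
      2 ^+ d * (2 * M * (4 * theta) ^+ 2 / delta)) * c k ^+ 2)%R))%E.
Proof.
move=> t0 hd us cs; have /andP[de0 de1] := hd.
pose e i : 'rV[int]_d := delta_mx ord0 i.
pose c1 i k := (c k - c (k - e i)) ^+ 2.
set c2 := (fun k => _ * c k ^+ 2).
have c20 k : 0 <= c2 k.
  apply: mulr_ge0; last exact: sqr_ge0.
  apply: addr_ge0; last exact: growth_error_ge0.
  by apply: mulr_ge0 => //; exact: growth_factor_ge0.
have c2s k : c2 k != 0 -> k \in s.
  by rewrite /c2 mulf_eq0 negb_or sqrf_eq0 => /andP[_ /cs].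
pose s1 i := undup (s ++ [seq k + e i | k <- s]).
have us1 i : uniq (s1 i) by exact: undup_uniq.
have c1s i k : c1 i k != 0 -> k \in s1 i.
  rewrite /c1 sqrf_eq0 mem_undup mem_cat => h.
  have [ck|/cs ->//] := eqVneq (c k) 0.
  apply/orP; right; apply/mapP; exists (k - e i); last by rewrite subrK.
  by apply: cs; move: h; rewrite ck sub0r oppr_eq0.
have mc1 i := measurable_average theta (mixed_profile i) (us1 i) (c1s i).
have mc2 := measurable_average theta (@cubics_profile R d) us c2s.
apply: (@le_trans _ _ (\int[@lebesgue_rV R d]_x
    ((\sum_(i < d) (average theta (mixed i) (c1 i) x)%:E) +
     (average theta cubics c2 x)%:E))%E).
  apply: ge0_le_integral => //.
  - move=> x _; rewrite lee_fin.
    exact: (energy_integrand_ge0 theta V0 (interpolant theta c)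
      (fun i => partial i (interpolant theta c))).
  - apply: (measurable_energy_integrand theta cV
      (G := fun i => partial i (interpolant theta c))).
    + exact: Ck_continuous (Ck_interpolant theta us cs).
    + move=> i; have [_ /(_ i)[_ Cp]] := Ck_interpolant theta us cs.
      exact: (@Ck_continuous _ _ 1 _ Cp).
  - by apply: emeasurable_funD => //; exact: emeasurable_sum.
  - move=> x _; rewrite sumEFin -EFinD lee_fin lerD//.
      rewrite mulr_sumr; apply: ler_sum => i _.
      rewrite -exprMn (partial_interpolant t0 us cs).
      exact: average_jensen (mixed_profile i).
    exact: potential_average_le.
rewrite ge0_integralD//; last 3 first.
- move=> x _; apply: sume_ge0 => i _; rewrite lee_fin; apply: average_ge0.
    exact: mixed_profile.
  by move=> k; exact: sqr_ge0.
- exact: emeasurable_sum.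
- by move=> x _; rewrite lee_fin average_ge0// => i; exact: cubics_profile.
rewrite (integral_average (@cubics_profile R d) t0 c2s c20).
rewrite ge0_muleDr ?kinetic_ge0 ?lsum_ge0//; apply: leeD => //.
rewrite ge0_integral_sum//; last first.
  move=> i x _; rewrite lee_fin; apply: average_ge0; first exact: mixed_profile.
  by move=> k; exact: sqr_ge0.
rewrite kineticE ge0_sume_distrr; last by move=> i _; exact: difference_energy_ge0.
rewrite le_eqVlt; apply/orP; left; apply/eqP; apply: eq_bigr => i _.
rewrite (integral_average (mixed_profile i) t0 (c1s i)); last first.
  by move=> k; exact: sqr_ge0.
rewrite -difference_energyN /difference_energy; congr (_ * lsum _)%E.
by apply/funext => k; rewrite /c1 -[RHS]sqrrN opprB.
Qed.

(** Integrating [average_sqr_le]: the average of c^2 integrates to theta ^ d |c|^2, that of the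
    oscillation is controlled by the kinetic energy. C depends on the shifts only, hence not on
    theta. *)
Lemma interpolant_norm_ge : exists2 C : R, 0 <= C &
  forall (theta : R) (c : 'rV[int]_d -> R) s, 0 < theta -> uniq s ->
  (forall k, c k != 0 -> k \in s) ->
  ((theta ^+ d)%:E * lsum (fun k => c k ^+ 2)%R <=
   \int[@lebesgue_rV R d]_x (interpolant theta c x ^+ 2)%:E +
   (theta ^+ d)%:E * (C%:E * kinetic c))%E.
Proof.
have [C C0 CP] := @lsum_oscillation R d; exists C => // theta c s t0 us cs.
have c2s k : c k ^+ 2 != 0 -> k \in s by rewrite sqrf_eq0 => /cs.
have osc0 k : 0 <= oscillation c k by apply: sumr_ge0 => FG _; exact: sqr_ge0.
(* The oscillation may be nonzero off the support of c, but only within a window difference of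
   it. *)
pose s' := undup (s ++ [seq k - (offset FG.1 - offset FG.2) | k <- s,
  FG <- enum {: {ffun 'I_d -> 'I_4} * {ffun 'I_d -> 'I_4}}]).
have oscs k : oscillation c k != 0 -> k \in s'.
  move=> o; rewrite mem_undup mem_cat; have [ck|/cs ->//] := eqVneq (c k) 0.
  apply/orP; right; apply: contraR o => ks.
  rewrite /oscillation big1// => FG _; rewrite ck subr0.
  apply/eqP; rewrite sqrf_eq0; apply: contraR ks => /cs h.
  apply/allpairsP; exists (k + (offset FG.1 - offset FG.2), FG); split => //.
    by rewrite mem_enum.
  by rewrite /= addrK.
rewrite -(integral_average (@cubics_profile R d) t0 c2s); last first.
  by move=> k; exact: sqr_ge0.
apply: (@le_trans _ _ (\int[@lebesgue_rV R d]_x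
   ((interpolant theta c x ^+ 2)%:E + (average theta cubics (oscillation c) x)%:E))%E).
  have mI : measurable_fun setT (fun x => (interpolant theta c x ^+ 2)%:E).
    apply/measurable_EFinP; apply: measurable_funX.
    by have /measurable_EFinP := measurable_average theta (@cubics_profile R d) us cs.
  apply: ge0_le_integral => //.
  - move=> x _; rewrite lee_fin; apply: average_ge0; first exact: cubics_profile.
    by move=> k; exact: sqr_ge0.
  - exact: measurable_average (@cubics_profile R d) us c2s.
  - apply: emeasurable_funD => //.
    exact: (measurable_average theta (@cubics_profile R d) (undup_uniq _) oscs).
  - move=> x _; rewrite -EFinD lee_fin; apply: average_sqr_le.
    exact: cubics_profile.
rewrite ge0_integralD//; last 4 first.
- by move=> x _; rewrite lee_fin sqr_ge0.
- apply/measurable_EFinP; apply: measurable_funX.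
  by have /measurable_EFinP := measurable_average theta (@cubics_profile R d) us cs.
- by move=> x _; rewrite lee_fin; apply: average_ge0 => // i; exact: cubics_profile.
- exact: (measurable_average theta (@cubics_profile R d) (undup_uniq _) oscs).
rewrite leeD2l// (integral_average (@cubics_profile R d) t0 oscs osc0).
by apply: lee_wpmul2l; [rewrite lee_fin exprn_ge0// ltW|exact: CP].
Qed.

(** The Rayleigh quotient of the interpolant, with theta ^ d cancelled between energy and norm.
    [C * K < N] ensures that the interpolant has positive norm. *)
Lemma mu_B_finite_support : exists2 C : R, 0 <= C &
  forall (theta delta : R) (c : 'rV[int]_d -> R) s (N K E : R),
  0 < theta -> 0 < delta <= 1 -> uniq s -> (forall k, c k != 0 -> k \in s) ->
  lsum (fun k => c k ^+ 2) = N%:E -> kinetic c = K%:E ->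
  lsum (fun k => V (lattice_point theta k) * c k ^+ 2) = E%:E -> C * K < N ->
  (mu_B V theta * (N - C * K)%:E <=
   (K + (1 + 2 ^+ d * delta) * E +
    2 ^+ d * (2 * M * (4 * theta) ^+ 2 / delta) * N)%:E)%E.
Proof.
have [C C0 CP] := interpolant_norm_ge; exists C => //.
move=> theta delta c s N K E t0 hd us cs NE KE EE CKN.
have /andP[de0 de1] := hd.
have td : 0 < theta ^+ d by rewrite exprn_gt0.
have Cg := Cc_interpolant t0 us cs; have Ckg := Ck_interpolant theta us cs.
pose S := fine (\int[@lebesgue_rV R d]_x (interpolant theta c x ^+ 2)%:E).
have SE : (\int[@lebesgue_rV R d]_x (interpolant theta c x ^+ 2)%:E)%E = S%:E.
  rewrite fineK//; apply: integrable_fin_num => //.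
  rewrite (_ : (fun x => _) =
    EFin \o (fun x => interpolant theta c x * interpolant theta c x)).
    by apply: Cc_integrable; apply: CcM => //; exact: Ck_continuous Ckg.
  by apply/funext => x /=; rewrite expr2.
have := CP theta c s t0 us cs; rewrite SE NE KE -!EFinM -EFinD lee_fin => NS.
have NS' : theta ^+ d * (N - C * K) <= S by lra.
have NK : 0 < N - C * K by rewrite subr_gt0.
have S0 : 0 < S by apply: lt_le_trans NS'; rewrite mulr_gt0.
have := mu_B_rayleigh theta V0 cV Cg Ckg S0 SE.
move=> /le_trans /(_ (interpolant_energy_le t0 hd us cs)) H.
set a := 1 + 2 ^+ d * delta in H *; set b := 2 ^+ d * (_ / delta) in H *.
have a0 : 0 <= a by exact: growth_factor_ge0.
have b0 : 0 <= b by exact: growth_error_ge0.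
have LE : lsum (fun k => (a * V (lattice_point theta k) + b) * c k ^+ 2) =
    (a * E + b * N)%:E.
  have h1 k : V (lattice_point theta k) * c k ^+ 2 != 0 -> k \in s.
    by rewrite mulf_eq0 negb_or sqrf_eq0 => /andP[_ /cs].
  have h2 k : c k ^+ 2 != 0 -> k \in s by rewrite sqrf_eq0 => /cs.
  have p1 k : 0 <= V (lattice_point theta k) * c k ^+ 2.
    by rewrite mulr_ge0 ?sqr_ge0.
  have p2 k : 0 <= c k ^+ 2 by exact: sqr_ge0.
  move: EE NE; rewrite (lsum_seq us p1 h1) (lsum_seq us p2 h2) => -[<-] [<-].
  rewrite (lsum_seq us); last 2 first.
  - by move=> k; rewrite mulr_ge0// addr_ge0// mulr_ge0.
  - by move=> k; rewrite mulf_eq0 negb_or => /andP[_ /h2].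
  congr (_%:E); rewrite !mulr_sumr -big_split /=; apply: eq_bigr => k _.
  by rewrite mulrDl mulrA.
move: H; rewrite LE KE -EFinD -EFinM addrA => H.
have B0 : (0 <= mu_B V theta)%E by exact: mu_B_ge0.
have : (mu_B V theta * (theta ^+ d * (N - C * K))%:E <=
    (theta ^+ d * (K + a * E + b * N))%:E)%E.
  apply: le_trans H; apply: lee_wpmul2l => //; by rewrite lee_fin.
rewrite [X in (_ * X)%E]EFinM [X in (_ <= X)%E]EFinM muleCA lee_pmul2l//.
Qed.

End energy_comparison.

(** * The discrete ground state *)

Arguments lsum {R d} c%_R.

Section discrete_energies.
Context {R : realType} {d : nat}.
Implicit Types (f c : 'rV[int]_d -> R) (s : seq 'rV[int]_d).

Definition restrict s f : 'rV[int]_d -> R := fun k => if k \in s then f k else 0.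

Lemma restrict_support s f k : restrict s f k != 0 -> k \in s.
Proof. by rewrite /restrict; case: ifP => //; rewrite eqxx. Qed.

(** The infinite sum is a supremum of finite ones, and squared norms add up over the disjoint
    supports of the restriction and the remainder. *)
Lemma lsum_tail f (eps : R) : lsum (fun k => f k ^+ 2)%R = 1%E -> 0 < eps ->
  exists2 s, uniq s &
    (lsum (fun k => (f k - restrict s f k) ^+ 2)%R <= eps%:E)%E.
Proof.
move=> f1 e0.
have : ((1 - eps)%:E < lsum (fun k => f k ^+ 2)%R)%E by rewrite f1 lte_fin; lra.
move=> /ereal_sup_gt[_ [A [finA _] <-]] hA.
pose s := finmap.enum_fset (fset_set A).
have us : uniq s by exact: finmap.fset_uniq.
exists s => //.
have sumA : (\sum_(k \in A) (f k ^+ 2)%:E)%E = (\sum_(k <- s) f k ^+ 2)%:E.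
  by rewrite fsbig_finite// sumEFin.
have rs : lsum (fun k => restrict s f k ^+ 2)%R = (\sum_(k <- s) f k ^+ 2)%:E.
  rewrite (lsum_seq us); last 2 first.
  - by move=> k; exact: sqr_ge0.
  - by move=> k; rewrite sqrf_eq0; exact: restrict_support.
  by congr (_%:E); apply: eq_big_seq => k ks; rewrite /restrict ks.
have split1 : (lsum (fun k => restrict s f k ^+ 2)%R +
    lsum (fun k => (f k - restrict s f k) ^+ 2)%R = 1)%E.
  rewrite -lsumD; last 2 first.
  - by move=> k; exact: sqr_ge0.
  - by move=> k; exact: sqr_ge0.
  rewrite -f1; congr lsum; apply/funext => k; rewrite /restrict.
  by case: ifP => _; rewrite ?subrr ?subr0 expr0n ?addr0 ?add0r.
rewrite sumA in hA; move: split1; rewrite rs.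
have := @lsum_ge0 _ _ (fun k => (f k - restrict s f k) ^+ 2) (fun k => sqr_ge0 _).
case: (lsum _) => [r||]//= r0; rewrite -EFinD => -[E].
by rewrite lee_fin; move: hA; rewrite lte_fin; lra.
Qed.

(** The set s consists of s0 and its neighbours, so an edge with exactly one end in s has both ends
    outside s0. A sharp cut thus adds at most the tail squared at its two ends, that is 2 * eps per
    direction. *)
Lemma cutoff f (eps : R) : lsum (fun k => f k ^+ 2)%R = 1%E -> 0 < eps ->
  exists s, [/\ uniq s, ((1 - eps)%:E <= lsum (fun k => restrict s f k ^+ 2)%R)%E &
    (kinetic (restrict s f) <= kinetic f + (2 * d%:R * eps)%:E)%E].
Proof.
move=> f1 e0; have [s0 us0 tail] := lsum_tail f1 e0.
pose e (i : 'I_d) : 'rV[int]_d := delta_mx ord0 i.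
pose s := undup (s0 ++ [seq k + e i | k <- s0, i <- enum 'I_d] ++
  [seq k - e i | k <- s0, i <- enum 'I_d]).
have ss0 k : k \in s0 -> k \in s by rewrite mem_undup mem_cat => ->.
have sp k i : k \in s0 -> k + e i \in s.
  move=> k0; rewrite mem_undup !mem_cat; apply/or3P; constructor 2.
  by apply/allpairsP; exists (k, i); rewrite mem_enum.
have sm k i : k + e i \in s0 -> k \in s.
  move=> k0; rewrite mem_undup !mem_cat; apply/or3P; constructor 3.
  by apply/allpairsP; exists (k + e i, i); rewrite mem_enum/= addrK.
pose r k := f k - restrict s0 f k.
exists s; split; first exact: undup_uniq.
- have : (1%E <= lsum (fun k => restrict s f k ^+ 2)%R + eps%:E)%E.
    rewrite -f1; apply: (@le_trans _ _ (lsum (fun k => restrict s f k ^+ 2)%R +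
      lsum (fun k => (f k - restrict s0 f k) ^+ 2)%R)%E); last exact: leeD2l.
    rewrite -lsumD; last 2 first.
    + by move=> k; exact: sqr_ge0.
    + by move=> k; exact: sqr_ge0.
    apply: le_lsum => k; rewrite /restrict.
    have [/ss0 ->|_] := boolP (k \in s0); first by rewrite lerDl sqr_ge0.
    by rewrite subr0 lerDr sqr_ge0.
  have := @lsum_ge0 _ _ (fun k => restrict s f k ^+ 2) (fun k => sqr_ge0 _).
  case: (lsum _) => [x||]//= _ h; last exact: leey.
  by move: h; rewrite -EFinD !lee_fin; lra.
- have step i : (difference_energy (restrict s f) (e i) <=
      difference_energy f (e i) + (2 * eps)%:E)%E.
    apply: (@le_trans _ _ (difference_energy f (e i) +
       (lsum (fun k => r (k + e i) ^+ 2)%R + lsum (fun k => r k ^+ 2)%R))%E).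
      rewrite -lsumD; last 2 first.
      + by move=> k; exact: sqr_ge0.
      + by move=> k; exact: sqr_ge0.
      rewrite /difference_energy -lsumD; last 2 first.
      + by move=> k; exact: sqr_ge0.
      + by move=> k; rewrite addr_ge0 ?sqr_ge0.
      apply: le_lsum => k; have S x : 0 <= x ^+ 2 :> R by exact: sqr_ge0.
      rewrite /r /restrict.
      have [ks|ks] := boolP (k \in s); have [kes|kes] := boolP (k + e i \in s).
      + by rewrite lerDl addr_ge0.
      + have /negbTE -> : k \notin s0 by apply: contra kes; exact: sp.
        by rewrite sub0r sqrrN subr0 addrA lerDr addr_ge0.
      + have /negbTE -> : k + e i \notin s0 by apply: contra ks; exact: sm.
        by rewrite !subr0 addrCA lerDl addr_ge0.
      + by rewrite subrr expr0n !addr_ge0.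
    rewrite (lsum_shift (fun k => r k ^+ 2)); apply: leeD2l.
    rewrite (_ : (2 * eps)%:E = (eps%:E + eps%:E)%E); first exact: leeD.
    by rewrite -EFinD; congr (_%:E); ring.
  rewrite !kineticE.
  apply: (@le_trans _ _ (\sum_(i < d) (difference_energy f (e i) + (2 * eps)%:E))%E).
    by apply: lee_sum => i _; exact: step.
  rewrite big_split /= leeD2l// sumEFin sumr_const card_ord lee_fin.
  by rewrite -[leLHS]mulr_natr mulrAC.
Qed.

End discrete_energies.

(** * The indicator of a box as a trial state for the discrete operator *)

Section trial_state.
Context {R : realType} {d : nat}.
Variables (V : 'rV[R]_d -> R) (M : R).
Hypotheses (M0 : 0 <= M) (V0 : forall x, 0 <= V x) (sV : smooth V).
Hypothesis VM : forall i x, `|iter_partial [:: i; i] V x| <= M.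

Lemma mu_A_ge0 theta : (0 <= mu_A V theta)%E.
Proof.
apply: le_ereal_inf_tmp => _ [f _ <-]; apply: adde_ge0; apply: esum_ge0 => k _.
  by rewrite lee_fin sqr_ge0.
by rewrite lee_fin mulr_ge0// sqr_ge0.
Qed.

Section box.
Variables (L : nat) (b : 'rV[int]_d).
Hypothesis L0 : (0 < L)%N.

Local Notation cell := {ffun 'I_d -> 'I_L}.

Definition box_point (F : cell) : 'rV[int]_d := \row_i (b ord0 i + (F i : nat)%:Z).

Definition box : seq 'rV[int]_d := [seq box_point F | F <- enum {: cell}].

Lemma uniq_box : uniq box.
Proof.
rewrite map_inj_uniq ?enum_uniq// => F G /rowP FG.
apply/ffunP => i; apply/val_inj.
by have := FG i; rewrite !mxE => /addrI[].
Qed.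

Lemma mem_box k : (k \in box) = [forall i, b ord0 i <= k ord0 i < b ord0 i + L%:Z].
Proof.
apply/mapP/forallP => [[F _ ->] i|h].
  by rewrite mxE lerDl ltrD2l lez_nat ltz_nat /= ltn_ord.
have kb i : (`|k ord0 i - b ord0 i|%N < L)%N.
  have /andP[h1 h2] := h i.
  by rewrite -ltz_nat gez0_abs ?subr_ge0// ltrBlDr addrC.
exists [ffun i => Ordinal (kb i)]; first by rewrite mem_enum.
apply/rowP => i; rewrite mxE ffunE /=; have /andP[h1 h2] := h i.
by rewrite gez0_abs ?subr_ge0// [RHS]addrC subrK.
Qed.

Lemma size_box : size box = (L ^ d)%N.
Proof. by rewrite size_map -cardE card_ffun !card_ord. Qed.

Lemma card_face (i : 'I_d) (j : 'I_L) :
  (\sum_(F : cell | F i == j :> 'I_L) 1)%N = (L ^ d.-1)%N.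
Proof.
rewrite sum1_card.
rewrite (eq_card (B := family (fun i' => if i' == i then pred1 j else predT))).
  rewrite card_family foldrE big_map big_enum /= (bigD1 i)//= eqxx card1 mul1n.
  rewrite (eq_bigr (fun=> L)) => [|i' /negbTE ->]; last by rewrite card_ord.
  rewrite prod_nat_const; congr (_ ^ _)%N.
  by rewrite (eq_card (B := predC1 i))// cardC1 card_ord.
move=> F; rewrite [LHS]inE; apply/idP/familyP => [Fi i'|/(_ i)].
  by case: eqVneq => // ->; rewrite inE.
by rewrite eqxx inE.
Qed.

Definition face (i : 'I_d) (j : nat) k : bool :=
  (k \in box) && (k ord0 i == b ord0 i + j%:Z).

Lemma lsum_face (i : 'I_d) (j : nat) (a : R) : (j < L)%N -> 0 <= a ->
  lsum (fun k => if face i j k then a else 0) = (a * (L ^ d.-1)%:R)%:E.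
Proof.
move=> jL a0; rewrite (lsum_seq uniq_box); last 2 first.
- by move=> k; case: ifP.
- by move=> k; rewrite /face; case: (k \in box) => //=; rewrite eqxx.
congr (_%:E); rewrite big_map big_enum /=.
rewrite -(card_face i (Ordinal jL)) natr_sum mulr_sumr [RHS]big_mkcond /=.
apply: eq_bigr => F _; rewrite /face mulr1.
have -> : box_point F \in box by apply: map_f; rewrite mem_enum.
by rewrite mxE /= (inj_eq (addrI _)) eqz_nat -val_eqE.
Qed.

(** Only the edges through the two faces orthogonal to direction i count: they leave layer [L.-1] or
    enter layer 0, and each face carries L ^ (d - 1) of them. *)
Lemma difference_energy_box (a : R) (i : 'I_d) :
  (difference_energy (fun k => if k \in box then a else 0)%R (delta_mx ord0 i) <=
   (2 * a ^+ 2 * (L ^ d.-1)%:R)%:E)%E.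
Proof.
have L1 : (L.-1 < L)%N by rewrite prednK.
pose e : 'rV[int]_d := delta_mx ord0 i.
have a2 : 0 <= a ^+ 2 by exact: sqr_ge0.
apply: (@le_trans _ _ (lsum (fun k => if face i L.-1 k then a ^+ 2 else 0)%R +
   lsum (fun k => if face i 0 (k + e) then a ^+ 2 else 0)%R)%E); last first.
  rewrite (lsum_shift (fun k => if face i 0 k then a ^+ 2 else 0)).
  rewrite !lsum_face// -EFinD lee_fin le_eqVlt; apply/orP; left; apply/eqP; ring.
rewrite -lsumD; last 2 first.
- by move=> k; case: ifP.
- by move=> k; case: ifP.
apply: le_lsum => k; rewrite -/e /face.
have ej j : e ord0 j = (j == i)%:R by rewrite mxE eqxx.
have [ks|ks] := boolP (k \in box); have [kes|kes] := boolP (k + e \in box) => /=.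
- by rewrite subrr expr0n; do 2 case: ifP => _; rewrite ?addr_ge0.
- suff -> : k ord0 i == b ord0 i + L.-1%:Z by rewrite sub0r sqrrN addr0.
  move: ks kes; rewrite !mem_box => /forallP h /forallPn[j].
  have /andP[h1 h2] := h j; rewrite mxE ej; case: eqVneq => [ji|_]; last first.
    by rewrite addr0 h1 h2.
  rewrite ji -[true%:R]/(1 : int) in h1 h2 *.
  move: (k ord0 i) (b ord0 i) h1 h2 => x y; lia.
- suff -> : (k + e) ord0 i == b ord0 i + 0%:Z by rewrite subr0 add0r.
  move: ks kes; rewrite !mem_box => /forallPn[j hj] /forallP h.
  have := h j; rewrite mxE ej; move: hj; case: eqVneq => [ji|_]; last first.
    by rewrite addr0 => /negbTE ->.
  rewrite ji mxE ej eqxx -[true%:R]/(1 : int).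
  move: (k ord0 i) (b ord0 i) => x y; lia.
- by rewrite subrr expr0n addr0.
Qed.

End box.

(** A normalised box of side L has kinetic energy at most 2 d / L, and V is O(t ^ 2) on it because V
    m = 0 and V has bounded second derivatives. *)
Lemma mu_A_le (theta t : R) (m : 'rV[R]_d) : 0 < theta -> 0 < t <= 1 ->
  theta <= t ^+ 2 -> V m = 0 -> (0 < d)%N ->
  (mu_A V theta <= ((2 * d%:R + 2 ^+ d * (8 * M)) * t)%:E)%E.
Proof.
move=> th0 /andP[t0 t1] tht Vm d0.
(* Chosen so that 1 / t < L <= 1 / t + 1: the lower bound makes the kinetic energy O(t), the upper
   one keeps the box close to m. *)
pose L := (Num.truncn t^-1).+1.
have tV1 : 1 <= t^-1 by rewrite invf_ge1.
have tV0 : 0 <= t^-1 by rewrite invr_ge0 ltW.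
have /andP[L1 L2] : (t^-1 < L%:R) && (L%:R <= t^-1 + 1).
  rewrite truncnS_gt /= /L -natr1 lerD2r.
  by have /andP[] := truncn_itv tV0.
have LR0 : 0 < L%:R :> R by rewrite ltr0n.
pose b : 'rV[int]_d := corner theta m.
pose a : R := (Num.sqrt (L ^ d)%:R)^-1.
have Ld0 : 0 < (L ^ d)%:R :> R by rewrite ltr0n expn_gt0.
have a2 : a ^+ 2 = (L ^ d)%:R^-1 by rewrite /a exprVn sqr_sqrtr// ltW.
pose f := fun k : 'rV[int]_d => if k \in box L b then a else 0.
have fs (g : 'rV[int]_d -> R) k : g k * f k ^+ 2 != 0 -> k \in box L b.
  by rewrite /f; case: ifP => //; rewrite expr0n mulr0 eqxx.
have f1 : l2_norm_sqr f = 1%E.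
  rewrite -[LHS]/(lsum (fun k => f k ^+ 2)) (lsum_seq (uniq_box L b)).
  - rewrite (eq_big_seq (fun=> (L ^ d)%:R^-1)); last first.
      by move=> k kb; rewrite /f kb a2.
    rewrite big_const_seq count_predT iter_addr addr0 size_box.
    by rewrite -[X in X%:E]mulr_natr mulVf// gt_eqF.
  - by move=> k; exact: sqr_ge0.
  - by move=> k; have := fs (fun=> 1) k; rewrite mul1r.
have kin : (kinetic f <= (2 * d%:R * t)%:E)%E.
  rewrite kineticE; apply: (@le_trans _ _ (\sum_(i < d) (2 * t)%:E)%E).
    apply: lee_sum => i _; apply: (le_trans (difference_energy_box _ _ _ _)) => //.
    have LdE : (L ^ d)%:R = L%:R * (L ^ d.-1)%:R :> R.
      by rewrite -natrM -expnS prednK.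
    have X0 : 0 < (L ^ d.-1)%:R :> R by rewrite ltr0n expn_gt0.
    rewrite lee_fin a2 LdE -mulrA ler_pM2l// invfM -mulrA mulVf ?gt_eqF// mulr1.
    by rewrite -[t]invrK lef_pV2 ?posrE ?invr_gt0// ltW.
  by rewrite sumEFin sumr_const card_ord lee_fin -[leLHS]mulr_natr mulrAC.
have tau k : k \in box L b ->
    forall i, `|lattice_point theta k ord0 i - m ord0 i| <= 2 * t.
  rewrite mem_box => /forallP h i; have /andP[] := h i.
  rewrite -(ler_int R) -(ltr_int R) intrD -[L%:Z%:~R]/(L%:R) /b mxE.
  have /andP[] := floor_itv (m ord0 i / theta); rewrite intrD.
  move: (Num.floor _)%:~R => B h1 h2 h3 h4; rewrite !mxE.
  rewrite -[X in _ - X](divfK (lt0r_neq0 th0)) [_ * theta]mulrC -mulrBr normrM.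
  rewrite (gtr0_norm th0).
  have : `|(k ord0 i)%:~R - m ord0 i / theta| <= t^-1 + 1.
    by rewrite ler_norml; move: h1 h2 h3 h4 L2 tV1; rewrite -[1%:~R]/(1 : R); lra.
  move=> /(ler_wpM2l (ltW th0)) /le_trans; apply.
  (* Here theta (1 / t + 1) <= t ^ 2 (1 / t + 1) = t + t ^ 2 <= 2 t. *)
  apply: (le_trans (ler_wpM2r _ tht)); first lra.
  rewrite expr2 mulrDr -mulrA mulfV ?lt0r_neq0// !mulr1.
  by nra.
have Vk k : k \in box L b -> V (lattice_point theta k) <= 2 ^+ d * (8 * M) * t.
  (* Taking delta = 1 is harmless: the multiplicative error falls on V m = 0. *)
  move=> /tau kb; have one1 : 0 < (1 : R) <= 1 by rewrite ltr01 /=.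
  have := potential_growth M0 V0 sV VM one1 kb.
  rewrite Vm mulr0 add0r divr1 => /le_trans; apply.
  rewrite -[leRHS]mulrA ler_pM2l ?exprn_gt0//.
  have t2 : t ^+ 2 <= t by rewrite expr2; nra.
  by have := ler_wpM2l M0 t2; lra.
have pot : (lsum (fun k => V (lattice_point theta k) * f k ^+ 2)%R <=
    (2 ^+ d * (8 * M) * t)%:E)%E.
  rewrite (lsum_seq (uniq_box L b)); last 2 first.
  - by move=> k; rewrite mulr_ge0 ?V0// sqr_ge0.
  - exact: fs.
  rewrite lee_fin; apply: (@le_trans _ _
    (\sum_(k <- box L b) 2 ^+ d * (8 * M) * t * a ^+ 2)).
    rewrite !big_seq; apply: ler_sum => k kb; rewrite /f kb.
    by apply: ler_wpM2r; [exact: sqr_ge0|exact: Vk].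
  rewrite big_const_seq count_predT iter_addr addr0 size_box a2.
  by rewrite -[leLHS]mulr_natr -mulrA mulVf ?mulr1// gt_eqF.
apply: (@le_trans _ _ (discrete_energy V theta f)).
  by apply: ereal_inf_lbound; exists f.
rewrite mulrDl EFinD; exact: leeD.
Qed.

End trial_state.

(** * Conclusion *)

Lemma fin_between {R : realType} (x : \bar R) (y : R) : (0 <= x)%E -> (x <= y%:E)%E ->
  exists r : R, [/\ x = r%:E, 0 <= r & r <= y].
Proof. by case: x => [r||]//; rewrite !lee_fin => ? ?; exists r. Qed.

(** The real arithmetic of [mu_comparison]: a and b stand for [mu_A] and [mu_B], q for theta ^ 2, w
    for theta ^ 2 / t; K, E, N are the kinetic energy, potential energy and squared norm of the
    cut-off function, and X is N - C * K. *)
Lemma absorb_errors {R : realFieldType} (D n M C4 t q w a b K E N X : R) :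
  1 <= D -> 0 <= n -> 0 <= M -> 0 < C4 -> 0 < t <= 1 -> 0 <= q <= w ->
  0 <= a -> 0 <= b -> 0 <= K -> N <= 1 -> C4 * t <= 1 / 2 ->
  K + E <= a + q + 2 * n * q -> 1 - C4 * t <= X ->
  b * X <= K + (1 + D * t) * E + 32 * D * M * w * N ->
  b <= (1 + (2 * C4 + D + 2 * C4 * D) * t) * a +
       2 * ((1 + D) * (1 + 2 * n) + 32 * D * M) * w.
Proof.
move=> D1 n0 M0 C40 /andP[t0 t1] /andP[q0 qw] a0 b0 K0 N1.
set eta := C4 * t => eta1 KE hX hb.
have w0 : 0 <= w by exact: le_trans qw.
have D0 : 0 <= D by exact: le_trans D1.
have eta0 : 0 <= eta by apply: mulr_ge0; exact: ltW.
have Dt0 : 0 <= D * t by apply: mulr_ge0 => //; exact: ltW.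
have DtD : D * t <= D by rewrite ler_piMr.
set A := 1 + D * t in hb *.
have A1 : 1 <= A by rewrite lerDl.
have A0 : 0 <= A by exact: le_trans A1.
set e := 32 * D * M * w in hb.
have e0 : 0 <= e by rewrite /e; apply: mulr_ge0 => //; apply: mulr_ge0 => //; apply: mulr_ge0.
set q' := q + 2 * n * q.
have q'0 : 0 <= q' by apply: addr_ge0 => //; apply: mulr_ge0 => //; apply: mulr_ge0.
set Q := A * (a + q') + e.
have Q0 : 0 <= Q by apply: addr_ge0 => //; apply: mulr_ge0 => //; exact: addr_ge0.
have hQ : b * (1 - eta) <= Q.
  apply: (le_trans (ler_wpM2l b0 hX)); apply: (le_trans hb).
  apply: lerD; last by rewrite ler_piMr.
  apply: (@le_trans _ _ (A * (K + E))); first by rewrite mulrDr lerD2r ler_peMl.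
  by apply: ler_wpM2l => //; rewrite /q' addrA.
have eta2 : 0 <= 1 - 2 * eta by lra.
(* Division by 1 - eta: (1 - eta) (1 + 2 eta) = 1 + eta (1 - 2 eta) >= 1 since eta <= 1 / 2. *)
have hbQ : b <= (1 + 2 * eta) * Q.
  have p0 : 0 <= 1 + 2 * eta by apply: addr_ge0 => //; exact: mulr_ge0.
  have h1 := ler_wpM2r p0 hQ.
  have h2 : 0 <= b * (eta * (1 - 2 * eta)).
    by apply: mulr_ge0 => //; exact: mulr_ge0.
  rewrite [leRHS]mulrC; apply: le_trans h1; rewrite -subr_ge0.
  by rewrite [leRHS](_ : _ = b * (eta * (1 - 2 * eta))); last ring.
have h3 : A * q' <= (1 + D) * (1 + 2 * n) * w.
  rewrite (_ : A * q' = A * (1 + 2 * n) * q); last by rewrite /q'; ring.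
  have n1 : 0 <= 1 + 2 * n by apply: addr_ge0 => //; exact: mulr_ge0.
  apply: ler_pM => //; first exact: mulr_ge0.
  by apply: ler_wpM2r => //; rewrite lerD2l.
pose c := (1 + D) * (1 + 2 * n) + 32 * D * M.
have Q1 : Q <= A * a + c * w.
  rewrite /Q mulrDr -addrA lerD2l [c * w]mulrDl; exact: lerD.
have c0 : 0 <= c * w.
  apply: mulr_ge0 => //; apply: addr_ge0; apply: mulr_ge0 => //.
  - exact: addr_ge0.
  - by apply: addr_ge0 => //; exact: mulr_ge0.
  - exact: mulr_ge0.
have p2 : 1 + 2 * eta <= 2 by move: eta2; rewrite subr_ge0 -(lerD2l 1).
apply: (le_trans hbQ); apply: (@le_trans _ _ ((1 + 2 * eta) * (A * a + c * w))).
  by apply: ler_wpM2l => //; apply: addr_ge0 => //; exact: mulr_ge0.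
rewrite mulrDr; apply: lerD; last by rewrite -mulrA; exact: ler_wpM2r.
rewrite mulrA; apply: ler_wpM2r => //.
(* As t <= 1, the quadratic term of (1 + 2 C4 t) (1 + D t) goes into the linear one, whence the
   coefficient of t in the conclusion. *)
have h4 : D * C4 * t ^+ 2 <= D * C4 * t.
  apply: ler_wpM2l; first by apply: mulr_ge0 => //; exact: ltW.
  by rewrite expr2 ler_piMl// ltW.
rewrite -subr_ge0 /A /eta.
rewrite [leRHS](_ : _ = 2 * (D * C4 * t - D * C4 * t ^+ 2)); last ring.
by apply: mulr_ge0 => //; rewrite subr_ge0.
Qed.

Section comparison.
Context {R : realType} {d : nat}.
Variables (V : 'rV[R]_d -> R).

(** A point with V <= t0 + inf V exists; coercivity at t0 yields a critical point, and the
    order-zero condition in its definition says V m = 0. *)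
Lemma coercive_zero (P : nat) : (forall x, 0 <= V x) -> coercive V P ->
  exists m, V m = 0.
Proof.
move=> V0 [t0 [K [t00 K1 cV]]].
have hinf : has_inf (range V).
  split; first by exists (V 0), 0.
  by exists 0 => _ [x _ <-].
have [_ [y _ <-] Vy] := inf_adherent t00 hinf.
have [|p [m [/andP[p2 _] [cm _] _]]] := cV t0 y (lexx _).
  by rewrite addrC ltW.
exists m; have := cm (fun=> 0%N).
rewrite -size_multi_index -[Dpartial _ V]/(iter_partial (multi_index _) V).
suff -> : multi_index (fun _ : 'I_d => 0%N) = [::].
  by apply; exact: leq_trans p2.
by apply: size0nil; rewrite size_multi_index /order_of big1.
Qed.

Lemma second_derivatives_bounded (P : nat) : (2 <= P)%N ->
  bounded_derivatives V P -> exists2 M : R, 0 <= M &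
  forall i x, `|iter_partial [:: i; i] V x| <= M.
Proof.
move=> P2 [M VM]; exists `|M| => // i x.
have := VM (fun j => 2 * (j == i))%N x.
rewrite -size_multi_index -[Dpartial _ V]/(iter_partial (multi_index _) V).
rewrite multi_index_nseq => /(_ P2) /le_trans; apply; exact: ler_norm.
Qed.

Variables (M : R) (m : 'rV[R]_d).
Hypotheses (M0 : 0 <= M) (V0 : forall x, 0 <= V x) (sV : smooth V).
Hypothesis VM : forall i x, `|iter_partial [:: i; i] V x| <= M.
Hypotheses (Vm : V m = 0) (d0 : (0 < d)%N).

(** The parameter t plays the role of delta and is left free: the multiplicative error is O(t), the
    additive one O(theta ^ 2 / t). *)
Lemma mu_comparison : exists C1 C2 C4 : R, [/\ 0 < C1, 0 < C2, 0 < C4 &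
  forall theta t : R, 0 < theta < 1 -> 0 < t <= 1 -> theta <= t ^+ 2 ->
  C4 * t <= 1 / 2 ->
  (mu_B V theta <= (1 + C1 * t)%:E * mu_A V theta +
                   (C2 * (theta ^+ 2 / t))%:E)%E].
Proof.
have [C C0 CP] := mu_B_finite_support M0 V0 sV VM.
pose D : R := 2 ^+ d; have D1 : 1 <= D by rewrite exprn_ege1// ler1n.
pose n : R := d%:R; have n0 : 0 <= n by rewrite ler0n.
pose C3 : R := 2 * n + D * (8 * M).
have C30 : 0 <= C3 by rewrite addr_ge0 ?mulr_ge0//; lra.
(* The kinetic energy after the cut-off is at most C3 t + theta ^ 2 + 2 n theta ^ 2, and theta ^ 2
   <= t. *)
pose C5 : R := C * (C3 + 1 + 2 * n).
have C50 : 0 <= C5 by rewrite mulr_ge0//; lra.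
(* The extra 1 pays for the mass lost in the cut-off, at most theta ^ 2 <= t. *)
pose C4 := 1 + C5.
pose C1 := 2 * C4 + D + 2 * C4 * D.
pose C2 := 2 * ((1 + D) * (1 + 2 * n) + 32 * D * M).
have C40 : 0 < C4 by rewrite /C4; lra.
have DM : 0 <= D * M by rewrite mulr_ge0//; lra.
have C10 : 0 < C1.
  have : 0 < C4 * D by rewrite mulr_gt0//; lra.
  by rewrite /C1; lra.
have C20 : 0 < C2.
  have : 0 <= D * n by rewrite mulr_ge0//; lra.
  by rewrite /C2; lra.
exists C1, C2, C4; split=> // theta t /andP[th0 th1] /andP[t0 t1] tht C4t.
have th2 : theta ^+ 2 <= t.
  apply: (@le_trans _ _ theta); first by rewrite expr2; nra.
  by apply: (le_trans tht); rewrite expr2; nra.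
have th20 : 0 < theta ^+ 2 by rewrite exprn_gt0.
have tt : 0 < t <= 1 by rewrite t0.
have := mu_A_ge0 V0 theta; have := mu_A_le M0 V0 sV VM th0 tt tht Vm d0.
(* The same slack theta ^ 2 serves for the near-minimiser and for the tail of the cut-off; it is
   below the additive error theta ^ 2 / t. *)
have := @lb_ereal_inf_adherent R _ _ th20.
move=> /(_ [set discrete_energy V theta f | f in [set f | l2_norm_sqr f = 1%E]]).
rewrite -/(mu_A V theta) => adh hi lo.
have [a [aE a0 hC3]] := fin_between lo hi.
have aC3 : a <= C3 * t by exact: hC3.
move: adh; rewrite aE => /(_ isT)[_ [f f1 <-] Ef].
pose pot c := lsum (fun k => V (lattice_point theta k) * c k ^+ 2).
have pot0 c : (0 <= pot c)%E.
  by apply: lsum_ge0 => k; rewrite mulr_ge0 ?V0// sqr_ge0.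
have {}Ef : (kinetic f + pot f <= (a + theta ^+ 2)%:E)%E by exact: ltW.
have [Kf [KfE Kf0 _]] : exists r : R, [/\ kinetic f = r%:E, 0 <= r & r <= a + theta ^+ 2].
  apply: fin_between; first exact: kinetic_ge0.
  by apply: le_trans Ef; rewrite leeDl.
have [Pf [PfE Pf0 _]] : exists r : R, [/\ pot f = r%:E, 0 <= r & r <= a + theta ^+ 2].
  apply: fin_between => //.
  by apply: le_trans Ef; rewrite leeDr// kinetic_ge0.
move: Ef; rewrite KfE PfE -EFinD lee_fin => Ef.
have [s [us hN hK]] := cutoff f1 th20.
set c := restrict s f in hN hK.
have c2f k : c k ^+ 2 <= f k ^+ 2.
  by rewrite /c /restrict; case: ifP => // _; rewrite expr0n sqr_ge0.
have [N [NE N0 N1]] : exists r : R, [/\ lsum (fun k => c k ^+ 2) = r%:E, 0 <= r & r <= 1].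
  apply: fin_between; first by apply: lsum_ge0 => k; exact: sqr_ge0.
  by rewrite -f1; exact: le_lsum.
have [K [KE K0 K1]] : exists r : R, [/\ kinetic c = r%:E, 0 <= r &
    r <= Kf + 2 * n * theta ^+ 2].
  by apply: fin_between; [exact: kinetic_ge0|rewrite EFinD -KfE].
have [E [EE E0 E1]] : exists r : R, [/\ pot c = r%:E, 0 <= r & r <= Pf].
  apply: fin_between => //; rewrite -PfE; apply: le_lsum => k.
  by apply: ler_wpM2l => //; exact: V0.
move: hN; rewrite NE lee_fin => hN.
have CK : C * K <= C5 * t.
  rewrite /C5 -mulrA; apply: ler_wpM2l => //.
  have h1 : n * theta ^+ 2 <= n * t by exact: ler_wpM2l.
  rewrite 2!mulrDl mul1r; lra.
have C4E : C4 * t = t + C5 * t by rewrite /C4 mulrDl mul1r.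
have CKN : C * K < N by lra.
have cs k : c k != 0 -> k \in s by exact: restrict_support.
have := CP theta t c s N K E th0 tt us cs NE KE EE CKN.
have B0 := mu_B_ge0 theta V0.
have NCK : 1 - C4 * t <= N - C * K by lra.
have hNCK : 0 < N - C * K by lra.
(* The value +oo would contradict the finite upper bound, since N - C * K > 0. *)
case: (mu_B V theta) B0 => [b||]// B0; last by rewrite gt0_mulye ?lte_fin.
move: B0; rewrite -EFinM -EFinM -EFinD !lee_fin => b0.
have w1 : theta ^+ 2 <= theta ^+ 2 / t by rewrite ler_pdivlMr// ler_piMr// ltW.
have eE : 2 ^+ d * (2 * M * (4 * theta) ^+ 2 / t) = 32 * D * M * (theta ^+ 2 / t).
  by rewrite -/D; field; exact: lt0r_neq0.
rewrite eE => hb; apply: (@absorb_errors _ D n M C4 t (theta ^+ 2) _ a b K E N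
  (N - C * K)) => //; first by rewrite w1 andbT ltW.
by apply: (le_trans (lerD K1 E1)); rewrite addrAC lerD2r.
Qed.

End comparison.

Theorem theorem1p4 (R : realType) (d P : nat) (V : 'rV[R]_d -> R) :
  (1 <= d)%N -> (2 <= P)%N ->
  (forall x, 0 <= V x) -> smooth V -> Zd_periodic V ->
  coercive V P -> bounded_derivatives V P ->
  exists C1 C2 theta0 : R, [/\ 0 < C1, 0 < C2, 0 < theta0 &
    forall theta : R, 0 < theta < 1 -> theta < theta0 ->
      (mu_B V theta
         - (C2 * theta `^ (2 - (3 * P%:R + 1) / (2 * P%:R * (P%:R + 1))))%:E
       <= (1 + C1 * theta `^ (1 / (2 * (P%:R + 1))))%:E * mu_A V theta)%E].
Proof.
move=> d1 P2 V0 sV _ cV bV.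
have [m Vm] := coercive_zero V0 cV.
have [M M0 VM] := second_derivatives_bounded P2 bV.
have [C1 [C2 [C4 [C10 C20 C40 H]]]] := mu_comparison M0 V0 sV VM Vm d1.
have P0 : 2 <= P%:R :> R by rewrite ler_nat.
set a : R := 1 / (2 * (P%:R + 1)).
have Pp : 0 < 2 * (P%:R + 1) :> R by lra.
have a0 : 0 < a by rewrite divr_gt0.
(* In terms of exponents, this is theta <= t ^ 2. *)
have a1 : a * 2 <= 1 by rewrite /a mulrAC ler_pdivrMr//; lra.
(* Since 2 (P + 1) a = 1, theta0 ^ a = 1 / (2 C4); below theta0 one has C4 t <= 1 / 2. *)
pose theta0 : R := (1 / (2 * C4)) `^ (2 * (P%:R + 1)).
exists C1, C2, theta0; split => //.
  by apply: powR_gt0; rewrite divr_gt0// mulr_gt0.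
move=> theta /andP[th0 th1] tht0.
pose t := theta `^ a.
have t0 : 0 < t by exact: powR_gt0.
have t1 : t <= 1 by rewrite -(powRr0 theta); apply: ger_powR; rewrite ?th0 /= ltW.
have tht : theta <= t ^+ 2.
  rewrite -(powR_mulrn 2 (ltW t0)) -powRrM -[leLHS](powRr1 (ltW th0)).
  by apply: ger_powR => //; rewrite th0 ltW.
have C4t : C4 * t <= 1 / 2.
  have : t <= theta0 `^ a by apply: ge0_ler_powR; rewrite ?nnegrE ?powR_ge0// ltW.
  have aP : 2 * (P%:R + 1) * a = 1 by rewrite /a mul1r mulfV// gt_eqF.
  have C42 : 0 < 2 * C4 by exact: mulr_gt0.
  rewrite /theta0 -powRrM aP powRr1; last by apply: divr_ge0 => //; exact: ltW.
  rewrite ler_pdivlMr// => h.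
  by rewrite ler_pdivlMr// mulrC mulrA mulrC.
rewrite leeBlDr//; apply: (le_trans (H theta t _ _ tht C4t)).
- by rewrite th0.
- by rewrite t0.
rewrite leeD2l// lee_fin ler_pM2l//.
have -> : theta ^+ 2 / t = theta `^ (2 - a).
  rewrite -(powR_mulrn 2 (ltW th0)) powRB//.
  by rewrite (gt_eqF th0) implybT.
apply: ger_powR; first by rewrite th0 ltW.
(* As theta < 1, the larger exponent 2 - a gives the smaller power; it exceeds the required exponent
   by (2 P + 1) / (2 P (P + 1)). *)
rewrite lerD2l lerN2 /a -subr_ge0.
rewrite [leRHS](_ : _ = (2 * P%:R + 1) / (2 * P%:R * (P%:R + 1))).
  by rewrite divr_ge0 ?mulr_ge0//; lra.
by field; rewrite !gt_eqF//; lra.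
Qed.
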